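(* Let $a$ be an indeterminate or a nonzero complex number, and let $|q|<1$. Define \[ S_a(q):=\sum_{m\ge0}\frac{(aq;q^2)_m(q/a;q^2)_m\, q^{2m}}{(-q^2;q^2)_m}, \qquad P_a(q):=(q^4;q^4)_\infty S_a(q). \] Then \[ P_a(q)\big|_{n\equiv 0\ (\mathrm{mod}\ 2)} = \sum_{n\ge0}(-1)^nq^{6n^2+4n}(1+q^{4n+2}) \sum_{j=-n}^{n}(-1)^j a^{2j}q^{-2j^2}, \] and \[ P_a(q)\big|_{n\equiv 1\ (\mathrm{mod}\ 2)} = \sum_{n\ge0}(-1)^{n+1}q^{6n^2+10n+3}(1+q^{4n+4}) \sum_{j=0}^{n}(-1)^j \big(a^{2j+1}+a^{-2j-1}\big)q^{-2j(j+1)}. \]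
   Context: Standard $q$-Pochhammer notation: $(x;q)_0=1$, $(x;q)_n=\prod_{j=0}^{n-1}(1-xq^j)$, $(x;q)_\infty=\prod_{j\ge0}(1-xq^j)$. For a series $F(q)=\sum_{n} A(n)q^n$ (coefficients possibly depending on $a$), $F(q)\big|_{n\equiv r\ (\mathrm{mod}\ N)}:=\sum_{n\equiv r \ (\mathrm{mod}\ N)}A(n)q^n$ denotes the part of $F$ supported on exponents congruent to $r$ modulo $N$. *)

(* Defs.v *)
From HB Require Import structures.
From mathcomp Require Import all_boot all_order all_algebra.
From mathcomp Require Export fraction complex.
From mathcomp Require Import all_classical all_reals all_analysis.
Set Implicit Arguments. Unset Strict Implicit. Unset Printing Implicit Defensive.
Import Order.TTheory GRing.Theory Num.Theory.
Import numFieldNormedType.Exports.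
Local Open Scope classical_set_scope.
Local Open Scope ring_scope.

Record fps (K : Type) := Fps { fps_coef : nat -> K }.

Section FpsRing.
Variable K : comNzRingType.
Implicit Types f g h : fps K.

HB.instance Definition _ := gen_eqMixin (fps K).
HB.instance Definition _ := gen_choiceMixin (fps K).

Lemma fpsP f g : (forall n, fps_coef f n = fps_coef g n) -> f = g.
Proof. by case: f g => [f] [g] /= fg; congr Fps; apply/funext. Qed.

Definition fps_const (c : K) := Fps (fun n => if n == 0%N then c else 0).
Definition fps_X := Fps (fun n => (n == 1%N)%:R : K).
Definition fps_add f g := Fps (fun n => fps_coef f n + fps_coef g n).
Definition fps_opp f := Fps (fun n => - fps_coef f n).
Definition fps_mul f g :=
  Fps (fun n => \sum_(i < n.+1) fps_coef f i * fps_coef g (n - i)).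

Fact fps_addA : associative fps_add.
Proof. by move=> f g h; apply: fpsP => n /=; rewrite addrA. Qed.
Fact fps_addC : commutative fps_add.
Proof. by move=> f g; apply: fpsP => n /=; rewrite addrC. Qed.
Fact fps_add0 : left_id (fps_const 0) fps_add.
Proof. by move=> f; apply: fpsP => n /=; rewrite if_same add0r. Qed.
Fact fps_addN : left_inverse (fps_const 0) fps_opp fps_add.
Proof. by move=> f; apply: fpsP => n /=; rewrite if_same addNr. Qed.

HB.instance Definition _ :=
  GRing.isZmodule.Build (fps K) fps_addA fps_addC fps_add0 fps_addN.

Let trunc n f : {poly K} := \poly_(i < n.+1) fps_coef f i.

Let coef_trunc n f i : (i <= n)%N -> (trunc n f)`_i = fps_coef f i.
Proof. by move=> le_in; rewrite coef_poly ltnS le_in. Qed.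

Let fps_mulE f g n i : (i <= n)%N ->
  fps_coef (fps_mul f g) i = (trunc n f * trunc n g)`_i.
Proof.
move=> le_in; rewrite coefM; apply: eq_bigr => j _.
by rewrite !coef_trunc // (leq_trans _ le_in) ?leq_subr // -ltnS.
Qed.

Let coefM_low (p p' r : {poly K}) n :
  (forall i, (i <= n)%N -> p`_i = p'`_i) -> (p * r)`_n = (p' * r)`_n.
Proof. by move=> pp'; rewrite !coefM; apply: eq_bigr => j _; rewrite pp' // -ltnS. Qed.

Fact fps_mulC : commutative fps_mul.
Proof.
by move=> f g; apply: fpsP => n; rewrite !(@fps_mulE _ _ n n) // mulrC.
Qed.
Fact fps_mulA : associative fps_mul.
Proof.
move=> f g h; apply: fpsP => n; rewrite fps_mulC !(@fps_mulE _ _ n n) //.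
rewrite (@coefM_low _ (trunc n g * trunc n h)) => [|i le_in]; last first.
  by rewrite coef_trunc // (@fps_mulE _ _ n).
rewrite [RHS](@coefM_low _ (trunc n f * trunc n g)) => [|i le_in]; last first.
  by rewrite coef_trunc // (@fps_mulE _ _ n).
by rewrite mulrC mulrA.
Qed.
Fact fps_mul1 : left_id (fps_const 1) fps_mul.
Proof.
move=> f; apply: fpsP => n /=; rewrite big_ord_recl /= mul1r subn0 big1 ?addr0 //.
by move=> i _; rewrite mul0r.
Qed.
Fact fps_mulD : left_distributive fps_mul fps_add.
Proof.
move=> f g h; apply: fpsP => n /=; rewrite -big_split /=.
by apply: eq_bigr => i _; rewrite mulrDl.
Qed.
Fact fps_1neq0 : fps_const 1 != fps_const 0.
Proof.
by apply/eqP => /(congr1 (fun f => fps_coef f 0)) /eqP; rewrite /= oner_eq0.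
Qed.

HB.instance Definition _ := GRing.Zmodule_isComNzRing.Build (fps K)
  fps_mulA fps_mulC fps_mul1 fps_mulD fps_1neq0.

Definition fps_unit : pred (fps K) := fun f => `[< exists g, g * f = 1 >].
Definition fps_inv f : fps K :=
  if pselect (exists g, g * f = 1) is left fU then projT1 (cid fU) else f.

Fact fps_mulV : {in fps_unit, left_inverse 1 fps_inv *%R}.
Proof.
move=> f /asboolP fU; rewrite /fps_inv; case: pselect => // fU'.
exact: (projT2 (cid fU')).
Qed.
Fact fps_unitP f g : g * f = 1 -> fps_unit f.
Proof. by move=> gf; apply/asboolP; exists g. Qed.
Fact fps_inv_out : {in [predC fps_unit], fps_inv =1 id}.
Proof.
by move=> f /asboolP nU; rewrite /fps_inv; case: pselect.
Qed.

HB.instance Definition _ := GRing.ComNzRing_hasMulInverse.Build (fps K)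
  fps_mulV fps_unitP fps_inv_out.

(* Convergence for the product of the discrete topologies: every coefficient
   is eventually constant. *)
Definition fps_cvg (u : nat -> fps K) (f : fps K) : Prop :=
  forall n, exists M, forall m, (M <= m)%N -> fps_coef (u m) n = fps_coef f n.

End FpsRing.

(* The part of a coefficient sequence supported on n = r (mod N). *)
Definition dissect (K : nmodType) (N r : nat) (A : nat -> K) (n : nat) : K :=
  if n == r %[mod N] then A n else 0.

Section QSeries.
Variable A : comUnitRingType.
Implicit Types a q x : A.

Definition qpoch x q (n : nat) : A := \prod_(j < n) (1 - x * q ^+ j).

Definition S_term a q (m : nat) : A :=
  qpoch (a * q) (q ^+ 2) m * qpoch (q / a) (q ^+ 2) m * q ^+ (2 * m)
    / qpoch (- q ^+ 2) (q ^+ 2) m.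

(* In the next two definitions the power of q in front of the inner sum has
   been multiplied into it: each exponent of q is then a nonnegative integer,
   so that the terms make sense for q = 0 and for a formal variable q, neither
   of which is invertible. *)
Definition even_term a q (n : nat) : A :=
  (-1) ^+ n * (1 + q ^+ (4 * n + 2)) *
  \sum_(k < (2 * n).+1)
    let j := k%:Z - n%:Z in
    (-1) ^ j * a ^ (2 * j) * q ^ ((6 * n ^ 2 + 4 * n)%N%:Z - 2 * j ^+ 2).

Definition odd_term a q (n : nat) : A :=
  (-1) ^+ n.+1 * (1 + q ^+ (4 * n + 4)) *
  \sum_(j < n.+1)
    (-1) ^+ j * (a ^ (2 * j%:Z + 1) + a ^ (- 2 * j%:Z - 1)) *
    q ^ ((6 * n ^ 2 + 10 * n + 3)%N%:Z - 2 * j%:Z * (j%:Z + 1)).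

(* cv u l reads "the sequence u converges to l". *)
Variable cv : (nat -> A) -> A -> Prop.

Definition has_sum (u : nat -> A) (s : A) : Prop :=
  cv (fun M => \sum_(m < M) u m) s.

Definition is_P a q (P : A) : Prop :=
  exists E S : A,
    [/\ cv (qpoch (q ^+ 4) (q ^+ 4)) E, has_sum (S_term a q) S & P = E * S].

End QSeries.

(* R[i], with its structure of numClosedFieldType made visible, from which the
   metric topology is inferred. *)
Definition Cplx (R : realType) : numClosedFieldType := R[i].

Definition Cplx_cvg (R : realType) (u : nat -> Cplx R) (l : Cplx R) : Prop :=
  u @ \oo --> l.

(* The field C(a) of rational functions in the indeterminate a; it contains
   the Laurent polynomials C[a, 1/a]. *)
Definition ratfun (R : realType) : fieldType := {fraction {poly Cplx R}}.

Definition indet (R : realType) : ratfun R := tofrac ('X : {poly Cplx R}).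

(* Main.v *)
(** Write [Q = q^2].  The finite Jacobi triple product expands the numerator of
the [m]-th term of [S_a] in the Laurent monomials [a^j]:
[(aq;Q)_m (q/a;Q)_m = sum_j (-1)^j a^j q^(j^2) [2m, m+j]_Q].
The coefficient [T_j] of [(-1)^j a^j q^(j^2)] in [S_a] satisfies, by a Gosper
telescoping in [m],
[T_j + Q^(3j+3) T_(j+2) = (Q^j + Q^(2j+1)) / (Q^2;Q^2)_oo].
Solving this recurrence and collecting the terms with [|j| + 2k = N] gives
[P_a = sum_N (1 + Q^(N+1)) H_N], with [H_0 = 1], [H_1 = - (a + 1/a) q^3] and
[H_N = (-1)^N (a^N + a^(-N)) q^(N^2+2N) - q^(6N-2) H_(N-2)].
Every exponent of [q] in [H_N] has the parity of [N], so the even and the odd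
part of [P_a] come from the even and the odd [N].

The summation by parts is done on partial sums: up to [m < M], the product of
[(q^4;q^4)_M] and [S_a] is [sum_(N < M) w_(M,N) (1 + Q^(N+1)) H_N] with
[w_(M,N) = [2M, M+N+1]_Q (Q;Q)_M], a finite product of factors [1 - Q^e] with
[e >= M - N], hence tending to [1]; this covers formal and complex [q] alike. *)
Require Import Defs.
From HB Require Import structures.
From mathcomp Require Import all_boot all_order all_algebra.
From mathcomp Require Import all_classical all_reals all_analysis.
From mathcomp Require Import zify ring lra.
Set Implicit Arguments. Unset Strict Implicit. Unset Printing Implicit Defensive.
Import Order.TTheory GRing.Theory Num.Theory.
Import numFieldNormedType.Exports.
Local Open Scope ring_scope.

(** * Partial sums of [S_a] *)

Section GaussianBinomials.
Variables (A : comUnitRingType) (q : A).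

(** The Gaussian binomial [[n, k]_q], given by the q-Pascal rule: the usual quotient would divide by
    [1 - q ^+ i], which need not be a unit. *)
Fixpoint gbin (n k : nat) : A :=
  match n, k with
  | _, 0 => 1
  | 0, _.+1 => 0
  | n'.+1, k'.+1 => gbin n' k' + q ^+ k'.+1 * gbin n' k'.+1
  end.

Lemma gbin0 n : gbin n 0 = 1. Proof. by case: n. Qed.

Lemma gbinS n k : gbin n.+1 k.+1 = gbin n k + q ^+ k.+1 * gbin n k.+1.
Proof. by []. Qed.

Lemma gbin_small n k : (n < k)%N -> gbin n k = 0.
Proof.
elim: n k => [|n IHn] [|k] //= nk.
by rewrite !IHn ?mulr0 ?addr0 // ltnW.
Qed.

(** The ratio of neighbours in a row, cleared of denominators. The dual Pascal rule, the product
    formula and the telescoping all rest on it. *)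
Lemma gbin_step n k : (1 - q ^+ k.+1) * gbin n k.+1 = (1 - q ^+ (n - k)) * gbin n k.
Proof.
elim: n k => [|n IHn] k; first by case: k => [|k] /=; rewrite ?subrr ?mul0r mulr0.
have [nk|kn] := ltnP n k.
  (* For [k = n + 1] the binomial on the right is 1, and its factor [1 - q ^+ 0] vanishes
     instead. *)
  rewrite gbin_small // mulr0; have [->|nk'] := eqVneq k n.+1.
    by rewrite subnn subrr mul0r.
  by rewrite gbin_small ?mulr0 // ltn_neqAle eq_sym nk'.
rewrite gbinS mulrDr mulrCA IHn.
case: k kn => [|k] kn; first by rewrite !subn0 !gbin0 expr1 exprS; ring.
have E := IHn k; rewrite gbinS subSS exprS.
have nk : (n - k = (n - k.+1).+1)%N by lia.
rewrite nk !exprS in E *.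
rewrite [RHS]mulrDr -E; ring.
Qed.

(** The two q-Pascal rules differ by exactly [gbin_step]. *)
Lemma gbin_dual n k : gbin n.+1 k.+1 = gbin n k.+1 + q ^+ (n - k) * gbin n k.
Proof.
rewrite gbinS; apply/eqP; rewrite -subr_eq0; apply/eqP.
transitivity ((1 - q ^+ (n - k)) * gbin n k - (1 - q ^+ k.+1) * gbin n k.+1); first by ring.
by rewrite gbin_step subrr.
Qed.

(** Double induction: the Pascal rule expands one side, its dual the other, and the expansions match
    term by term. *)
Lemma gbin_sym k l : gbin (k + l) k = gbin (k + l) l.
Proof.
elim: k l => [|k IHk] l.
  rewrite add0n gbin0; elim: l => //= l <-.
  by rewrite (gbin_small (ltnSn l)) mulr0 addr0.
elim: l => [|l IHl].
  rewrite addn0 gbin0 gbinS (gbin_small (ltnSn k)) mulr0 addr0.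
  by have := IHk 0; rewrite addn0 gbin0.
rewrite addSn gbinS [RHS]gbin_dual.
rewrite IHk -addSnnS IHl; congr (_ + q ^+ _ * _); lia.
Qed.

(* For [n < k] the truncated [n - i] gives a factor [1 - q ^+ 0 = 0]. *)
Lemma gbin_falling n k : gbin n k * qpoch q q k = \prod_(i < k) (1 - q ^+ (n - i)).
Proof.
elim: k => [|k IHk]; first by rewrite /qpoch !big_ord0 gbin0 mulr1.
rewrite /qpoch !big_ord_recr /= -IHk -/(qpoch q q k) -exprS.
transitivity (((1 - q ^+ k.+1) * gbin n k.+1) * qpoch q q k); first by ring.
by rewrite gbin_step; ring.
Qed.

End GaussianBinomials.
Arguments gbin : simpl never.

(** * The finite Jacobi triple product and the telescoping in [m] *)

Section FiniteTripleProduct.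
Variables (A : comUnitRingType) (a ai q : A).
Hypothesis aai : a * ai = 1.
Let Q := q ^+ 2.

(** Collects the monomials [a^j] and [a^(-j)] with their sign, so that symmetric sums over integers
    become sums over naturals; at [j = 0] they coincide and count once. *)
Definition jcoef (j : nat) : A :=
  if j is 0 then 1 else (-1) ^+ j * (a ^+ j + ai ^+ j).

Lemma jcoef1 : jcoef 1 = - (a + ai). Proof. by rewrite /jcoef !expr1 mulN1r. Qed.

Lemma jcoef2 : (a + ai) * jcoef 1 = - (jcoef 2 + jcoef 0 + jcoef 0).
Proof.
have -> : jcoef 0 = a * ai by [].
rewrite jcoef1 /jcoef; ring.
Qed.

Lemma jcoefS j : (a + ai) * jcoef j.+2 = - (jcoef j.+3 + jcoef j.+1).
Proof.
rewrite /jcoef.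
have -> : a ^+ j.+1 = (a * ai) * a ^+ j.+1 by rewrite aai mul1r.
have -> : ai ^+ j.+1 = (a * ai) * ai ^+ j.+1 by rewrite aai mul1r.
rewrite !exprS; ring.
Qed.

Let g m j := gbin Q (2 * m) (m + j).

(** Two Pascal steps lead from row [2m] to row [2m + 2], the outer one by [gbinS] and the inner ones
    by [gbin_dual]. This is the recurrence that a new pair of factors imposes on the coefficients of
    the triple product. *)
Lemma gbin_center_step m j : (j <= m)%N ->
  g m.+1 j.+1 = (1 + Q ^+ (2 * m).+1) * g m j.+1 + Q ^+ (m - j) * g m j
    + Q ^+ (m + j.+2) * g m j.+2.
Proof.
move=> jm; rewrite /g.
have -> : (2 * m.+1 = (2 * m).+2)%N by lia.
rewrite !addnS !addSn gbinS (gbin_dual _ _ (m + j)).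
have -> : (2 * m - (m + j) = m - j)%N by lia.
(* At [j = m] truncated subtraction would break the exponent sum used below, but the binomials
   concerned vanish. *)
have [->|jm'] := eqVneq j m.
  by rewrite !(@gbin_small _ _ _ (m + m).+1) ?(@gbin_small _ _ _ (m + m).+2) //; try lia; ring.
rewrite (gbin_dual _ _ (m + j).+1) mulrDr mulrA -exprD.
have -> : ((m + j).+2 + (2 * m - (m + j).+1) = (2 * m).+1)%N by lia.
ring.
Qed.

(** At the centre the neighbours [j = 1] and [j = -1] agree by symmetry, hence the doubled
    [g m 1]. *)
Lemma gbin_center_step0 m :
  g m.+1 0 = (1 + Q ^+ (2 * m).+1) * g m 0 + Q ^+ m.+1 * (g m 1 + g m 1).
Proof.
rewrite /g !addn0 addn1; have -> : (2 * m.+1 = (2 * m).+2)%N by lia.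
have E : gbin Q (2 * m).+1 m = gbin Q (2 * m).+1 m.+1.
  have -> : ((2 * m).+1 = m + m.+1)%N by lia.
  exact: gbin_sym.
rewrite gbinS E {1}gbinS gbin_dual.
have -> : (2 * m - m = m)%N by lia.
have -> : ((2 * m).+1 = m.+1 + m)%N by lia.
rewrite exprD; ring.
Qed.

Let F j := jcoef j * q ^+ (j ^ 2).

(* [(a + ai) * jcoef 1] contains [jcoef 0] twice, whence the special case. *)
Let H m j :=
  match j with
  | 0 => 0
  | 1 => Q ^+ m.+1 * (F 0 + F 0)
  | i.+2 => Q ^+ (m + i.+2) * F i.+1
  end.

Let QF x j : Q ^+ x * F j = jcoef j * q ^+ (2 * x + j ^ 2).
Proof. by rewrite /F mulrCA -exprM -exprD. Qed.

(** Multiplication by [a + ai] moves [j] to [j + 1] and [j - 1]; the squares in the exponents turn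
    [q^(2m+1)] into [Q^(m-j)] and [Q^(m+j)]. [H] holds the downward half. *)
Let F_step m j : (j <= m)%N ->
  - ((a + ai) * q ^+ (2 * m).+1) * F j = Q ^+ (m - j) * F j.+1 + H m j.
Proof.
move=> jm; transitivity (- ((a + ai) * jcoef j) * q ^+ ((2 * m).+1 + j ^ 2)).
  by rewrite /F exprD; ring.
case: j jm => [|[|j]] jm; rewrite /H ?(mulrDr _ (F 0)) !QF.
- by rewrite mulr1 addr0 jcoef1; congr (_ * q ^+ _); lia.
- by rewrite jcoef2 opprK !mulrDl -addrA; congr (_ * q ^+ _ + (_ * q ^+ _ + _ * q ^+ _)); lia.
- by rewrite jcoefS opprK mulrDl; congr (_ * q ^+ _ + _ * q ^+ _); nia.
Qed.

(** Induction on [m]: the new pair of factors is [1 + Q^(2m+1) - (a + ai) q^(2m+1)], and comparing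
    coefficients of [F j] reproduces [gbin_center_step]. *)
Lemma finite_triple_product m :
  qpoch (a * q) Q m * qpoch (q * ai) Q m =
  \sum_(j < m.+1) g m j * (jcoef j * q ^+ (j ^ 2)).
Proof.
elim: m => [|m IHm].
  by rewrite /qpoch !big_ord0 big_ord_recl big_ord0 /= /g gbin0 exp0n // expr0 !mulr1 addr0.
rewrite [qpoch (a * q) Q m.+1]big_ord_recr [qpoch (q * ai) Q m.+1]big_ord_recr.
rewrite -/(qpoch (a * q) Q m) -/(qpoch (q * ai) Q m).
set x := qpoch _ _ _ in IHm *; set y := qpoch _ _ _ in IHm *.
transitivity ((1 + Q ^+ (2 * m).+1) * (x * y) + - ((a + ai) * q ^+ (2 * m).+1) * (x * y)).
  have -> : q ^+ (2 * m).+1 = q * Q ^+ m by rewrite exprS exprM.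
  have -> : Q ^+ (2 * m).+1 = (a * ai) * q ^+ 2 * Q ^+ m * Q ^+ m.
    by rewrite aai mul1r exprS mul2n -addnn exprD mulrA.
  by rewrite /=; ring.
have gz j : (m < j)%N -> g m j = 0 by move=> mj; rewrite /g gbin_small //; lia.
(* The ranges are padded with vanishing binomials, so that after the upward and downward shifts all
   tails run over [j <= m]. *)
transitivity ((1 + Q ^+ (2 * m).+1) * (\sum_(j < m.+2) g m j * F j) +
   (\sum_(j < m.+1) Q ^+ (m - j) * g m j * F j.+1 + \sum_(j < m.+3) g m j * H m j)).
  rewrite IHm; congr (_ + _).
    by congr (_ * _); rewrite [RHS]big_ord_recr /= (gz m.+1) // mul0r addr0.
  rewrite [\sum_(j < m.+3) _]big_ord_recr [\sum_(j < m.+2) _]big_ord_recr /=.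
  rewrite (gz m.+1) // (gz m.+2) // !mul0r !addr0 -big_split mulr_sumr.
  apply: eq_bigr => j _ /=; rewrite -/(F j) mulrCA F_step; last by rewrite -ltnS.
  by ring.
rewrite [RHS]big_ord_recl gbin_center_step0 [\sum_(j < m.+2) g m j * F j]big_ord_recl.
rewrite [\sum_(j < m.+3) _]big_ord_recl [\sum_(j < m.+2) _]big_ord_recl.
have term j : (j <= m)%N -> g m.+1 j.+1 * F j.+1 =
    (1 + Q ^+ (2 * m).+1) * (g m j.+1 * F j.+1) + Q ^+ (m - j) * g m j * F j.+1
    + Q ^+ (m + j.+2) * g m j.+2 * F j.+1.
  by move=> jm; rewrite gbin_center_step // 2!mulrDl -mulrA.
rewrite [X in _ = _ + X](_ : _ = \sum_(j < m.+1)
    ((1 + Q ^+ (2 * m).+1) * (g m j.+1 * F j.+1) + Q ^+ (m - j) * g m j * F j.+1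
    + Q ^+ (m + j.+2) * g m j.+2 * F j.+1)); last first.
  by apply: eq_bigr => j _; rewrite -term // -ltnS.
rewrite 2!big_split -mulr_sumr -/(F 0).
have -> : \sum_(i < m.+1) g m (lift ord0 i) * F (lift ord0 i) = \sum_(i < m.+1) g m i.+1 * F i.+1.
  by apply: eq_bigr => i _; rewrite lift0.
have -> : \sum_(i < m.+1) g m (lift ord0 (lift ord0 i)) * H m (lift ord0 (lift ord0 i)) =
    \sum_(i < m.+1) Q ^+ (m + i.+2) * g m i.+2 * F i.+1.
  by apply: eq_bigr => i _; rewrite !lift0 /H mulrCA mulrA.
rewrite lift0 -[H m 1]/(Q ^+ m.+1 * (F 0 + F 0)) mulr0.
move: (\sum_(_ < _) _) (\sum_(_ < _) _) (\sum_(_ < _) _) => s1 s2 s3.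
move: (F 0) (g m 0) (g m 1) (Q ^+ _) (Q ^+ _) => f0 g0 g1 Q1 Q2.
rewrite /=; ring.
Qed.

(** The [H_N] of the introduction, not the local [H]; the sign [(-1)^N] sits inside [jcoef], and
    [6N - 2] is [6L + 10] at [N = L + 2]. *)
Fixpoint hecke (N : nat) : A :=
  match N with
  | 0 => 1
  | 1 => jcoef 1 * q ^+ 3
  | (L.+1 as M).+1 => jcoef L.+2 * q ^+ (L.+2 ^ 2 + 2 * L.+2) - q ^+ (6 * L + 10) * hecke L
  end.

Lemma hecke1 : hecke 1 = jcoef 1 * q ^+ 3. Proof. by []. Qed.

Lemma heckeSS L :
  hecke L.+2 = jcoef L.+2 * q ^+ (L.+2 ^ 2 + 2 * L.+2) - q ^+ (6 * L + 10) * hecke L.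
Proof. by []. Qed.

(** The Gosper certificate cleared of denominators: after division by [(-Q;Q)_(m+1)] the right side
    is [1 + Q^(j+1)] times the increment in [m] of [g m j.+1 / (-Q;Q)_m]. *)
Let g_telescope m j : (j <= m)%N ->
  (1 + Q ^+ m.+1) * (Q ^+ (m - j) * g m j + Q ^+ (m + 2 * j + 3) * g m j.+2) =
  (1 + Q ^+ j.+1) * (g m.+1 j.+1 - (1 + Q ^+ m.+1) * g m j.+1).
Proof.
move=> jm; rewrite gbin_center_step //.
(* The exponent [m - j - 1] used below needs [j < m]; at [j = m] both higher binomials in row [2m]
   vanish. *)
have [->|jm'] := eqVneq j m.
  rewrite subnn expr0 mul1r.
  have -> : g m m.+1 = 0 by rewrite /g gbin_small //; lia.
  have -> : g m m.+2 = 0 by rewrite /g gbin_small //; lia.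
  by ring.
have := gbin_step Q (2 * m) (m + j); have := gbin_step Q (2 * m) (m + j.+1).
rewrite -/(g m j) -(addnS m j) -(addnS m j.+1) -/(g m j.+1) -/(g m j.+2).
have -> : (2 * m - (m + j) = (m - j.+1).+1)%N by lia.
have -> : (2 * m - (m + j.+1) = m - j.+1)%N by lia.
have -> : (m - j = (m - j.+1).+1)%N by lia.
have -> : Q ^+ (m + j.+2) = Q ^+ (m - j.+1) * Q ^+ j * Q ^+ j * Q ^+ 3.
  by rewrite -!exprD; congr (_ ^+ _); lia.
have -> : Q ^+ (m + j.+1) = Q ^+ (m - j.+1) * Q ^+ j * Q ^+ j * Q ^+ 2.
  by rewrite -!exprD; congr (_ ^+ _); lia.
have -> : Q ^+ (2 * m).+1 = Q ^+ (m - j.+1) * Q ^+ (m - j.+1) * Q ^+ j * Q ^+ j * Q ^+ 3.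
  by rewrite -!exprD; congr (_ ^+ _); lia.
have -> : Q ^+ (m + 2 * j + 3) = Q ^+ (m - j.+1) * Q ^+ j * Q ^+ j * Q ^+ j * Q ^+ 4.
  by rewrite -!exprD; congr (_ ^+ _); lia.
have -> : Q ^+ m.+1 = Q ^+ (m - j.+1) * Q ^+ j * Q ^+ 2.
  by rewrite -!exprD; congr (_ ^+ _); lia.
rewrite !(exprS _ j) !(exprS _ (m - j.+1)).
move: (g m j) (g m j.+1) (g m j.+2) (Q ^+ (m - j.+1)) (Q ^+ j) => x0 x1 x2 s r E2 E1.
apply/eqP; rewrite -subr_eq0; apply/eqP.
(* With [s = Q^(m-j-1)] and [r = Q^j], the difference of the two sides is a combination of the two
   neighbour relations among [g m j], [g m j.+1] and [g m j.+2]. *)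
transitivity (s * r * Q ^+ 2 * ((1 - s * r * r * Q ^+ 2) * x1 - (1 - Q * s) * x0)
  + s * r ^+ 2 * Q ^+ 3 * ((1 - s) * x1 - (1 - s * r * r * Q ^+ 3) * x2)); first by ring.
by rewrite E1 E2 !subrr !mulr0 addr0.
Qed.

(** The recursion of [hecke] read backwards. It makes the coefficient of [hecke j] in the expanded
    triple product equal to the bracket on the left of [g_telescope]. *)
Let hecke_jcoef m j : (j <= m)%N ->
  Q ^+ m * F j = Q ^+ (m - j) * hecke j +
    (if j is i.+2 then Q ^+ (m + 2 * i + 3) * hecke i else 0).
Proof.
case: j => [|[|j]] jm.
- by rewrite addr0 subn0 /F exp0n // expr0 mulr1.
- by rewrite addr0 QF /= mulrCA -exprM -exprD; congr (_ * _ ^+ _); lia.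
- rewrite heckeSS QF mulrBr mulrCA [X in _ = _ - X + _]mulrA -!exprM -!exprD.
  have -> : (2 * (m - j.+2) + (6 * j + 10) = 2 * (m + 2 * j + 3))%N by lia.
  by rewrite subrK; congr (_ * _ ^+ _); lia.
Qed.

(** For [ai = a^-1] the left side is the [m]-th term of [S_a] times [(-Q;Q)_(m+1)]; collecting by
    [hecke j] lets [g_telescope] act on each coefficient. *)
Lemma S_term_hecke m :
  (1 + Q ^+ m.+1) * (Q ^+ m * (qpoch (a * q) Q m * qpoch (q * ai) Q m)) =
  \sum_(j < m.+1) (g m.+1 j.+1 - (1 + Q ^+ m.+1) * g m j.+1) * ((1 + Q ^+ j.+1) * hecke j).
Proof.
have gz j : (m < j)%N -> g m j = 0 by move=> mj; rewrite /g gbin_small //; lia.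
rewrite finite_triple_product mulr_sumr.
(* [G] holds the contributions to [hecke i] coming from [j = i + 2], ready for an index shift by
   two. *)
pose G j := if j is i.+2 then g m i.+2 * (Q ^+ (m + 2 * i + 3) * hecke i) else 0.
transitivity ((1 + Q ^+ m.+1) *
  (\sum_(j < m.+1) g m j * (Q ^+ (m - j) * hecke j) + \sum_(j < m.+3) G j)).
  have G0 j : (m < j)%N -> G j = 0 by case: j => [|[|j]] //= /gz ->; rewrite mul0r.
  have -> : \sum_(j < m.+3) G j = \sum_(j < m.+1) G j.
    rewrite big_ord_recr [in LHS]big_ord_recr (G0 m.+2) // (G0 m.+1) //.
    exact: (etrans (addr0 _) (addr0 _)).
  congr (_ * _); rewrite -big_split; apply: eq_bigr => j _.
  rewrite -/(F j) mulrCA hecke_jcoef; last by rewrite -ltnS.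
  rewrite mulrDr; congr (_ + _).
  by rewrite /G; case: (nat_of_ord j) => [|[|i]] //; rewrite mulr0.
rewrite [\sum_(j < m.+3) _]big_ord_recl [\sum_(j < m.+2) _]big_ord_recl.
rewrite [G ord0]/(0 : A) [G (lift ord0 ord0)]/(0 : A) !add0r.
rewrite -big_split mulr_sumr; apply: eq_bigr => j _; rewrite !lift0.
transitivity ((1 + Q ^+ j.+1) * (g m.+1 j.+1 - (1 + Q ^+ m.+1) * g m j.+1) * hecke j); last first.
  move: (g m.+1 j.+1) (g m j.+1) (hecke j) (Q ^+ m.+1) (Q ^+ j.+1) => x0 x1 x2 x3 x4.
  by ring.
rewrite -g_telescope; last by rewrite -ltnS.
rewrite -[G j.+2]/(g m j.+2 * (Q ^+ (m + 2 * j + 3) * hecke j)).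
move: (g m j) (g m j.+2) (hecke j) (Q ^+ m.+1) (Q ^+ (m - j)) (Q ^+ _) => x0 x1 x2 x3 x4 x5.
by rewrite /=; ring.
Qed.

End FiniteTripleProduct.

(** * Partial sums of the product [P_a] *)

Section PartialSums.
Variable A : comUnitRingType.
Implicit Types a ai q x : A.

Lemma qpochD x q m n : qpoch x q (m + n) = qpoch x q m * qpoch (x * q ^+ m) q n.
Proof.
rewrite /qpoch big_split_ord; congr (_ * _).
by apply: eq_bigr => i _ /=; rewrite exprD mulrA.
Qed.

Lemma qpochS x q n : qpoch x q n.+1 = qpoch x q n * (1 - x * q ^+ n).
Proof. by rewrite /qpoch big_ord_recr. Qed.

Definition weight q M N := gbin q (2 * M) (M + N.+1) * qpoch q q M.

(** By symmetry the lower index becomes [M - N - 1], and the denominator of the falling product then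
    cancels the initial part of [(q;q)_M]. *)
Lemma weightE q M N : (N < M)%N ->
  weight q M N = qpoch (q ^+ (M + N + 2)) q (M - N.+1) * qpoch (q ^+ (M - N)) q N.+1.
Proof.
move=> NM; rewrite /weight.
have e2M : (2 * M = (M - N.+1) + (M + N.+1))%N by lia.
have -> : qpoch q q M = qpoch q q (M - N.+1) * qpoch (q * q ^+ (M - N.+1)) q N.+1.
  by rewrite -qpochD subnK.
rewrite e2M -gbin_sym mulrA gbin_falling -exprS.
have -> : (M - N.+1).+1 = (M - N)%N by lia.
congr (_ * _); rewrite /qpoch [RHS](reindex_inj rev_ord_inj); apply: eq_bigr => i _ /=.
by rewrite -exprD; congr (1 - q ^+ _); have := ltn_ord i; lia.
Qed.

Variables (a ai q : A).
Hypothesis aai : a * ai = 1.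
Let Q := q ^+ 2.
Hypothesis unitQ : forall k, 1 + Q ^+ k.+1 \is a GRing.unit.

Let D m := qpoch (- Q) Q m.

Lemma qpochN_step m : D m.+1 = D m * (1 + Q ^+ m.+1).
Proof. by rewrite /D qpochS mulNr opprK -exprS. Qed.

Lemma qpochN_unit m : D m \is a GRing.unit.
Proof.
elim: m => [|m IHm]; first by rewrite /D /qpoch big_ord0 unitr1.
by rewrite qpochN_step unitrMl.
Qed.

(** Passing from [M] to [M + 1] multiplies the left side by [1 + Q^(M+1)] and adds the expression of
    [S_term_hecke], which is exactly what the right side gains. *)
Lemma S_term_sum M :
  D M * \sum_(m < M) S_term a q m =
  \sum_(N < M) gbin Q (2 * M) (M + N.+1) * ((1 + Q ^+ N.+1) * hecke a ai q N).
Proof.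
have aiE : a^-1 = ai.
  have aU : a \is a GRing.unit by apply/unitrP; exists ai; rewrite mulrC aai.
  by apply: (mulrI aU); rewrite divrr // aai.
elim: M => [|M IHM]; first by rewrite !big_ord0 mulr0.
have -> : D M.+1 * \sum_(m < M.+1) S_term a q m =
    (1 + Q ^+ M.+1) * (D M * \sum_(m < M) S_term a q m) + D M.+1 * S_term a q M.
  by rewrite big_ord_recr /= mulrDr {1}qpochN_step mulrAC [in LHS]mulrC mulrA.
rewrite IHM.
have -> : D M.+1 * S_term a q M =
    (1 + Q ^+ M.+1) * (Q ^+ M * (qpoch (a * q) Q M * qpoch (q * ai) Q M)).
  rewrite /S_term -/Q -/(D M) aiE qpochN_step exprM -/Q.
  by rewrite [LHS]mulrC [LHS]mulrA divrK ?qpochN_unit // mulrC [_ * Q ^+ M]mulrC.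
rewrite S_term_hecke // -/Q.
set g1 := \sum_(_ < M) _.
(* The index [N = M] may be included, since [[2M, 2M + 1] = 0]. *)
have -> : g1 = \sum_(N < M.+1) gbin Q (2 * M) (M + N.+1) * ((1 + Q ^+ N.+1) * hecke a ai q N).
  by rewrite big_ord_recr /= gbin_small ?mul0r ?addr0 //; lia.
rewrite mulr_sumr -big_split; apply: eq_bigr => N _.
by rewrite /=; ring.
Qed.

Lemma P_sum M :
  qpoch (q ^+ 4) (q ^+ 4) M * \sum_(m < M) S_term a q m =
  \sum_(N < M) weight Q M N * ((1 + Q ^+ N.+1) * hecke a ai q N).
Proof.
(* Since [1 - Q^(2k) = (1 - Q^k)(1 + Q^k)], this factor contains the common denominator of the
   partial sum. *)
have -> : qpoch (q ^+ 4) (q ^+ 4) M = qpoch Q Q M * D M.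
  rewrite /D /qpoch -big_split /=; apply: eq_bigr => i _.
  rewrite -[q ^+ 4]/(q ^+ (2 * 2)) exprM -/Q -exprM mulnC exprM; ring.
rewrite -mulrA S_term_sum mulr_sumr; apply: eq_bigr => N _.
by rewrite /weight mulrA [qpoch _ _ _ * _]mulrC.
Qed.

End PartialSums.

(** * The terms of the two double sums through [hecke] *)

Section HeckeTerms.
Variables (A : comUnitRingType) (a q : A).
Hypothesis aU : a \is a GRing.unit.

Let t n (j : int) : A :=
  (-1) ^ j * a ^ (2 * j) * q ^ ((6 * n ^ 2 + 4 * n)%N%:Z - 2 * j ^+ 2).

(** The shift is [6L + 10] at [L = 2n], as in the recursion of [hecke]. *)
Let t_shift n (j : int) : - n%:Z <= j <= n%:Z -> t n.+1 j = q ^+ (12 * n + 10) * t n j.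
Proof.
move=> jn; rewrite /t [RHS]mulrCA; congr (_ * _).
(* For [|j| <= n] the exponent is nonnegative, so the integer power splits even if [q] is not a
   unit. *)
have [e Ee] : exists e : nat, (6 * n ^ 2 + 4 * n)%N%:Z - 2 * j ^+ 2 = e%:Z.
  exists (absz ((6 * n ^ 2 + 4 * n)%N%:Z - 2 * j ^+ 2)%R); rewrite gez0_abs //; nia.
have -> : (6 * n.+1 ^ 2 + 4 * n.+1)%N%:Z - 2 * j ^+ 2 = (12 * n + 10 + e)%N%:Z.
  by rewrite [RHS]PoszD -Ee; nia.
by rewrite Ee -!exprnP exprD.
Qed.

Let t_ends n (j : int) : j = n%:Z \/ j = - n%:Z ->
  (-1) ^+ n * t n j = a ^ (2 * j) * q ^+ ((2 * n) ^ 2 + 2 * (2 * n)).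
Proof.
move=> jn; rewrite /t mulrA [X in X * _]mulrA.
have -> : (-1) ^+ n * (-1) ^ j = 1 :> A.
  case: jn => ->; first by rewrite -exprnP -exprD addnn -mul2n exprM sqrrN expr1n expr1n.
  by rewrite -exprz_inv invrN1 -exprnP -exprD addnn -mul2n exprM sqrrN expr1n expr1n.
rewrite mul1r; have -> : (6 * n ^ 2 + 4 * n)%N%:Z - 2 * j ^+ 2 = ((2 * n) ^ 2 + 2 * (2 * n))%N%:Z.
  by case: jn => ->; rewrite ?sqrrN; nia.
by rewrite -exprnP.
Qed.

(** From [n] to [n + 1] the inner terms scale as in the recursion, the change of the outer sign
    gives its minus, and the two new end terms make up [jcoef]. *)
Lemma even_term_hecke n :
  even_term a q n = (1 + (q ^+ 2) ^+ (2 * n).+1) * hecke a a^-1 q (2 * n).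
Proof.
rewrite /even_term -(exprM q); have -> : (2 * (2 * n).+1 = 4 * n + 2)%N by lia.
rewrite [_ * (1 + _)]mulrC -mulrA; congr (_ * _).
under eq_bigr do rewrite /= -/(t n _).
elim: n => [|n IHn].
  rewrite big_ord_recl big_ord0 addr0 t_ends; last by left.
  by rewrite subrr mulr0 expr0z mul1r.
have -> : (2 * n.+1 = (2 * n).+2)%N by lia.
rewrite big_ord_recl big_ord_recr heckeSS -IHn.
rewrite (eq_bigr (fun i : 'I_(2 * n).+1 => q ^+ (12 * n + 10) * t n (i%:Z - n%:Z))); last first.
  move=> i _; rewrite -t_shift; last by have := ltn_ord i; lia.
  by congr (t _ _); rewrite /= /bump /=; lia.
rewrite -mulr_sumr !mulrDr !t_ends; [|by left; rewrite /= /bump /=; lia|by right; rewrite sub0r].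
rewrite addrCA addrC; congr (_ + _); last first.
  by rewrite exprS mulN1r mulNr mulrCA; congr (- (q ^+ _ * _)); lia.
have -> : (2 * n.+1 = (2 * n).+2)%N by lia.
rewrite -mulrDl; congr (_ * _).
rewrite /jcoef; have -> : (-1) ^+ (2 * n).+2 = 1 :> A.
  by rewrite -[(2 * n).+2]/(2 + 2 * n)%N -mulnS exprM sqrrN !expr1n.
rewrite mul1r addrC; congr (_ + _).
  by rewrite exprnP; congr (_ ^ _); rewrite /= /bump /=; lia.
by rewrite exprnP exprz_inv; congr (_ ^ _); rewrite /=; lia.
Qed.

Let s n (j : nat) : A :=
  (-1) ^+ j * (a ^ (2 * j%:Z + 1) + a ^ (- 2 * j%:Z - 1)) *
    q ^ ((6 * n ^ 2 + 10 * n + 3)%N%:Z - 2 * j%:Z * (j%:Z + 1)).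

(** Here [12n + 16] is [6L + 10] at [L = 2n + 1]. *)
Let s_shift n j : (j <= n)%N -> s n.+1 j = q ^+ (12 * n + 16) * s n j.
Proof.
move=> jn; rewrite /s [RHS]mulrCA; congr (_ * _).
have [e Ee] : exists e : nat, (6 * n ^ 2 + 10 * n + 3)%N%:Z - 2 * j%:Z * (j%:Z + 1) = e%:Z.
  exists (absz ((6 * n ^ 2 + 10 * n + 3)%N%:Z - 2 * j%:Z * (j%:Z + 1))%R); rewrite gez0_abs //; nia.
have -> : (6 * n.+1 ^ 2 + 10 * n.+1 + 3)%N%:Z - 2 * j%:Z * (j%:Z + 1) = (12 * n + 16 + e)%N%:Z.
  by rewrite [RHS]PoszD -Ee; nia.
by rewrite Ee -!exprnP exprD.
Qed.

Let s_end n : (-1) ^+ n.+1 * s n n = jcoef a a^-1 (2 * n).+1 * q ^+ ((2 * n).+1 ^ 2 + 2 * (2 * n).+1).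
Proof.
rewrite /s mulrA; congr (_ * _); last first.
  have -> : (6 * n ^ 2 + 10 * n + 3)%N%:Z - 2 * n%:Z * (n%:Z + 1) =
      ((2 * n).+1 ^ 2 + 2 * (2 * n).+1)%N%:Z.
    by nia.
  by rewrite -exprnP.
rewrite /jcoef mulrA; congr (_ * (_ + _)).
  by rewrite -exprD; congr (_ ^+ _); lia.
  by rewrite exprnP; congr (_ ^ _); lia.
by rewrite exprnP exprz_inv; congr (_ ^ _); lia.
Qed.

(** The same recursion at odd indices; a step adds a single end term, as [a^(2j+1)] and its inverse
    already share one. *)
Lemma odd_term_hecke n :
  odd_term a q n = (1 + (q ^+ 2) ^+ (2 * n).+2) * hecke a a^-1 q (2 * n).+1.
Proof.
rewrite /odd_term -(exprM q); have -> : (2 * (2 * n).+2 = 4 * n + 4)%N by lia.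
rewrite [_ * (1 + _)]mulrC -mulrA; congr (_ * _).
under eq_bigr do rewrite -/(s n _).
elim: n => [|n IHn].
  by rewrite big_ord_recl big_ord0 addr0 s_end.
have -> : ((2 * n.+1).+1 = (2 * n).+3)%N by lia.
rewrite big_ord_recr heckeSS -IHn mulrDr s_end.
rewrite (eq_bigr (fun i : 'I_n.+1 => q ^+ (12 * n + 16) * s n i)); last first.
  by move=> i _; rewrite -s_shift // -ltnS.
rewrite -mulr_sumr addrC; congr (_ + _).
  by have -> : ((2 * n.+1).+1 = (2 * n).+3)%N by lia.
by rewrite exprS mulN1r mulNr mulrCA; congr (- (q ^+ _ * _)); lia.
Qed.
End HeckeTerms.

(** * Transport along ring morphisms and splitting by parity *)

Lemma rmorph_jcoef (A B : comUnitRingType) (f : {rmorphism A -> B}) a ai j :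
  f (jcoef a ai j) = jcoef (f a) (f ai) j.
Proof. by case: j => [|j]; rewrite /jcoef ?rmorph1 // rmorphM rmorphD !rmorphXn rmorphN1. Qed.

(** One polynomial over the constants thus specialises both to a formal and to a complex [q]. *)
Lemma rmorph_hecke (A B : comUnitRingType) (f : {rmorphism A -> B}) a ai q N :
  f (hecke a ai q N) = hecke (f a) (f ai) (f q) N.
Proof.
elim/ltn_ind: N => -[|[|N]] IHN; first by rewrite rmorph1.
  by rewrite !hecke1 rmorphM rmorph_jcoef rmorphXn.
rewrite !heckeSS rmorphB (rmorphM _ (jcoef _ _ _)) rmorph_jcoef.
by rewrite (rmorphM _ (q ^+ (6 * N + 10))) !rmorphXn IHN.
Qed.

(** [F N i] stands for the coefficient of [q^i] in the [N]-th summand: its exponents share the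
    parity of [N], so selecting exponents mod 2 selects the indices [2n + r]. *)
Lemma dissect_sum (K : nmodType) (F : nat -> nat -> K) (r M k : nat) :
  (r < 2)%N -> (k < M)%N ->
  (forall N i, (i < N)%N -> F N i = 0) ->
  (forall N i, odd i != odd N -> F N i = 0) ->
  \sum_(n < M) F (2 * n + r)%N k = dissect 2 r (fun i => \sum_(N < i.+1) F N i) k.
Proof.
move=> r2 kM Flow Fpar.
have tail L L' : (k < L)%N -> \sum_(N < (L + L')%N) F N k = \sum_(N < L) F N k.
  move=> kL; rewrite big_split_ord /= [X in _ + X]big1 ?addr0 // => i _.
  by rewrite Flow //=; lia.
rewrite /dissect; case: ifPn => kr; last first.
  apply: big1 => n _; apply: Fpar; apply: contra kr => /eqP kr.
  by rewrite !modn2 kr oddD oddM /= eqxx.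
(* The range is stretched to even length, so that the induction takes one even and one odd [N] at a
   time. *)
have -> : \sum_(N < k.+1) F N k = \sum_(N < (2 * M)%N) F N k.
  have -> : (2 * M = k.+1 + (2 * M - k.+1))%N by lia.
  by rewrite tail.
elim: M {kM tail} => [|M IHM]; first by rewrite !big_ord0.
have -> : (2 * M.+1 = (2 * M).+2)%N by lia.
rewrite !big_ord_recr /= -IHM -addrA; congr (_ + _).
case: r r2 kr {IHM} => [|[|]] //= _; rewrite !modn2 /= => kr.
  by rewrite addn0 (Fpar (2 * M).+1) ?addr0 //= oddM /=; case: (odd k) kr.
by rewrite addn1 (Fpar (2 * M)%N) ?add0r // oddM /=; case: (odd k) kr.
Qed.

(** * The summands as polynomials in [q] *)

Section HeckePoly.
Variables (K : fieldType) (a : K).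

Definition hecke_poly (N : nat) : {poly K} :=
  (1 + ('X ^+ 2) ^+ N.+1) * hecke a%:P a^-1%:P 'X N.

Let jcoefP j : jcoef a%:P a^-1%:P j = (jcoef a a^-1 j)%:P.
Proof. by rewrite rmorph_jcoef. Qed.

(** The bound survives the recursion because [N(N+2) + 6N + 10] exceeds [(N+2)(N+4)], the parity
    because [6N + 10] is even. *)
Let hecke_support N i :
  (hecke a%:P a^-1%:P 'X N)`_i != 0 -> (N * (N + 2) <= i)%N /\ odd i = odd N.
Proof.
elim/ltn_ind: N i => -[|[|N]] IHN i.
- by rewrite coef1; case: i => //= i; rewrite eqxx.
- rewrite hecke1 jcoefP coefCM coefXn; case: (eqVneq i 3) => [->|] //.
  by rewrite mulr0 eqxx.
rewrite heckeSS jcoefP coefB coefCM coefXn coefXnM.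
case: (eqVneq i) => [->|iN]; first by split; [lia | rewrite oddD oddX oddM /= addbF].
rewrite mulr0 sub0r oppr_eq0; case: ltnP => [_|iN' nz]; first by rewrite eqxx.
have [] := IHN N _ _ nz => // le1; rewrite oddB // => od; split; first by nia.
move: od; rewrite oddD !oddM /= addbF /= => ->; by rewrite negbK.
Qed.

Lemma hecke_poly_support N i :
  (hecke_poly N)`_i != 0 -> (N * (N + 2) <= i)%N /\ odd i = odd N.
Proof.
rewrite /hecke_poly mulrDl mul1r coefD -exprM coefXnM.
case: ltnP => [_|iN]; first by rewrite addr0; exact: hecke_support.
have [->|/hecke_support[] le1 od] := eqVneq (hecke a%:P a^-1%:P 'X N)`_i 0; last by [].
rewrite add0r => /hecke_support[le1 od]; split; first by lia.
by rewrite -od oddB // oddM /= addbF.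
Qed.

Lemma hecke_poly_low N i : (i < N)%N -> (hecke_poly N)`_i = 0.
Proof. by move=> iN; apply/eqP; apply: contraTT iN => /hecke_poly_support[]; nia. Qed.

Lemma hecke_poly_parity N i : odd i != odd N -> (hecke_poly N)`_i = 0.
Proof. by apply: contraNeq => /hecke_poly_support[_ ->]. Qed.

End HeckePoly.

(** * Formal power series *)

Section FpsConvergence.
Variable K : fieldType.
Implicit Types (f g h : fps K) (u v : nat -> fps K).

(* [fps_low n f] says [f = O(q^n)]. *)
Definition fps_low (n : nat) f := forall i, (i < n)%N -> fps_coef f i = 0.

Lemma fps_lowW m n f : (m <= n)%N -> fps_low n f -> fps_low m f.
Proof. by move=> mn nf i im; rewrite nf // (leq_trans im). Qed.

Lemma fps_lowD n f g : fps_low n f -> fps_low n g -> fps_low n (f + g).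
Proof. by move=> nf ng i i_n; rewrite /= nf // ng // addr0. Qed.

Lemma fps_lowN n f : fps_low n f -> fps_low n (- f).
Proof. by move=> nf i i_n; rewrite /= nf // oppr0. Qed.

Lemma fps_lowM m n f g : fps_low m f -> fps_low n g -> fps_low (m + n) (f * g).
Proof.
move=> mf ng i i_mn /=; apply: big1 => j _.
have [jm|mj] := ltnP j m; first by rewrite mf // mul0r.
by rewrite ng ?mulr0 //; have := ltn_ord j; lia.
Qed.

Lemma fps_lowMl n f g : fps_low n f -> fps_low n (f * g).
Proof. by move=> nf; rewrite -[n]addn0; apply: fps_lowM. Qed.

Lemma fps_lowMr n f g : fps_low n g -> fps_low n (f * g).
Proof. by rewrite mulrC; exact: fps_lowMl. Qed.

Lemma fps_low_sum (I : finType) n (F : I -> fps K) :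
  (forall i, fps_low n (F i)) -> fps_low n (\sum_i F i).
Proof.
move=> nF; elim/big_ind: _ => [i _|f g|i _]; [by rewrite /= if_same|exact: fps_lowD|exact: nF].
Qed.

Lemma fps_lowXn n : fps_low n (fps_X K ^+ n).
Proof.
elim: n => [|n IHn] //; rewrite exprS -add1n; apply: fps_lowM IHn.
by case.
Qed.

Lemma fps_lowX n m f : fps_low m f -> fps_low (n * m) (f ^+ n).
Proof.
move=> mf; elim: n => [|n IHn]; first by [].
by rewrite exprS mulSn; apply: fps_lowM.
Qed.

Lemma eq_fps_low f g : (forall n, fps_low n (f - g)) -> f = g.
Proof.
move=> fg; apply/eqP; rewrite -subr_eq0; apply/eqP.
by apply: fpsP => n; rewrite (fg n.+1) //= if_same.
Qed.

Lemma fps_low_cvg u f : (forall n, fps_low n (f - u n)) -> fps_cvg u f.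
Proof.
move=> uf n; exists n.+1 => m nm.
by have /eqP := uf m n nm; rewrite /= subr_eq0 => /eqP.
Qed.

(** A diagonal limit: coefficient [k] is read at index [k + 1], where it is final as soon as every
    [u n.+1 - u n] is [O(q^n)]. *)
Definition fps_lim u : fps K := Fps (fun k => fps_coef (u k.+1) k).

Lemma fps_low_lim u : (forall n, fps_low n (u n.+1 - u n)) -> forall n, fps_low n (fps_lim u - u n).
Proof.
move=> du n i i_n; apply/eqP; rewrite /= subr_eq0; apply/eqP.
rewrite -(subnK i_n); elim: (n - i.+1)%N => [|k IHk] //.
rewrite IHk addSn; apply/esym/eqP; rewrite -subr_eq0; apply/eqP.
by apply: (du (k + i.+1)%N); lia.
Qed.

(** The inverse is the geometric series in [- f]. *)
Lemma fps_unit1D f : fps_low 1 f -> 1 + f \is a GRing.unit.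
Proof.
move=> f1; pose u n := \sum_(k < n) (- f) ^+ k.
have lowf n : fps_low n ((- f) ^+ n) by have := @fps_lowX n 1 (- f) (fps_lowN f1); rewrite muln1.
have du n : fps_low n (u n.+1 - u n) by rewrite /u big_ord_recr /= addrAC subrr add0r.
apply/unitrPr; exists (fps_lim u); apply: eq_fps_low => n.
have -> : (1 + f) * fps_lim u - 1 = (1 + f) * (fps_lim u - u n) - (- f) ^+ n.
  have -> : (- f) ^+ n = 1 - (1 + f) * u n.
    by rewrite -[LHS](subrK 1) subrX1 -/(u n); ring.
  by ring.
by apply: fps_lowD (fps_lowN _); [apply: fps_lowMr; exact: fps_low_lim | exact: lowf].
Qed.

Lemma fps_low_qpoch n (x q : fps K) m : fps_low n x -> fps_low n (qpoch x q m - 1).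
Proof.
move=> nx; elim: m => [|m IHm]; first by rewrite /qpoch big_ord0 subrr => i _ /=; rewrite if_same.
rewrite qpochS mulrBr mulr1 addrAC; apply: fps_lowD => //; apply/fps_lowN/fps_lowMr/fps_lowMl; exact: nx.
Qed.

End FpsConvergence.

(** * Polynomials inside formal power series *)

Section FpsOfPoly.
Variable K : fieldType.

Definition fps_of_poly (p : {poly K}) : fps K := Fps (fun n => p`_n).

Fact fps_of_poly_zmod : zmod_morphism fps_of_poly.
Proof. by move=> p r; apply: fpsP => n; rewrite /= coefB. Qed.
Fact fps_of_poly_monoid : monoid_morphism fps_of_poly.
Proof.
split; first by apply: fpsP => n; rewrite /= coef1; case: n.
by move=> p r; apply: fpsP => n; rewrite /= coefM.
Qed.
HB.instance Definition _ := GRing.isZmodMorphism.Build _ _ fps_of_poly fps_of_poly_zmod.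
HB.instance Definition _ := GRing.isMonoidMorphism.Build _ _ fps_of_poly fps_of_poly_monoid.

Lemma fps_of_polyC c : fps_of_poly c%:P = fps_const c.
Proof. by apply: fpsP => n; rewrite /= coefC. Qed.
Lemma fps_of_polyX : fps_of_poly 'X = fps_X K.
Proof. by apply: fpsP => n; rewrite /= coefX. Qed.

Lemma fps_const_unit (c : K) : c != 0 ->
  (fps_const c)^-1 = fps_const c^-1 /\ fps_const c \is a GRing.unit.
Proof.
move=> c0; have VK : fps_const c^-1 * fps_const c = 1 :> fps K.
  by rewrite -!fps_of_polyC -rmorphM -polyCM mulVf // rmorph1.
have cU : fps_const c \is a GRing.unit by apply/unitrPr; exists (fps_const c^-1); rewrite mulrC.
by split=> //; apply: (mulIr cU); rewrite mulVr.
Qed.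
End FpsOfPoly.

(** * The identity for formal [q] *)

Section FormalIdentity.
Variables (K : fieldType) (c : K).
Hypothesis c0 : c != 0.
Let a : fps K := fps_const c.
Let q : fps K := fps_X K.
Let z := hecke_poly c.

Let aV : a^-1 = fps_const c^-1. Proof. by have [] := fps_const_unit c0. Qed.
Let aU : a \is a GRing.unit. Proof. by have [] := fps_const_unit c0. Qed.

Let fps_of_z N : fps_of_poly (z N) = (1 + (q ^+ 2) ^+ N.+1) * hecke a a^-1 q N.
Proof.
rewrite /z /hecke_poly rmorphM rmorphD rmorph1 !rmorphXn rmorph_hecke /=.
by rewrite !fps_of_polyC fps_of_polyX aV.
Qed.

Let unitQ k : 1 + (q ^+ 2) ^+ k.+1 \is a GRing.unit.
Proof. by apply: fps_unit1D; rewrite -exprM; apply: fps_lowW (@fps_lowXn K _); lia. Qed.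

Let E := fps_lim (qpoch (q ^+ 4) (q ^+ 4)).
Let S := fps_lim (fun M => \sum_(m < M) S_term a q m).

Let lowE n : fps_low n (E - qpoch (q ^+ 4) (q ^+ 4) n).
Proof.
apply: fps_low_lim => {}n; rewrite qpochS mulrBr mulr1 addrAC subrr add0r.
by apply/fps_lowN/fps_lowMr; rewrite -exprS -exprM; apply: fps_lowW (@fps_lowXn K _); lia.
Qed.

Let lowS n : fps_low n (S - \sum_(m < n) S_term a q m).
Proof.
apply: fps_low_lim => {}n; rewrite big_ord_recr /= addrAC subrr add0r /S_term.
by apply/fps_lowMl/fps_lowMr; apply: fps_lowW (@fps_lowXn K _); lia.
Qed.

Let fps_low_weight M N : (N < M)%N -> fps_low (M - N) (weight (q ^+ 2) M N - 1).
Proof.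
move=> NM; rewrite weightE //.
set x := qpoch _ _ _; set y := qpoch _ _ _.
have -> : x * y - 1 = (x - 1) * y + (y - 1) by ring.
apply: fps_lowD; first apply: fps_lowMl; apply: fps_low_qpoch;
  rewrite -exprM; apply: fps_lowW (@fps_lowXn K _); lia.
Qed.

Let lowP n : fps_low n (E * S - \sum_(N < n) fps_of_poly (z N)).
Proof.
have := P_sum (mulrV aU) unitQ n.
set En := qpoch _ _ n; set Sn := \sum_(m < n) _ => PE.
have -> : E * S - \sum_(N < n) fps_of_poly (z N) = (E - En) * S + En * (S - Sn)
    + (En * Sn - \sum_(N < n) fps_of_poly (z N)) by ring.
apply: fps_lowD; first by apply: fps_lowD; [apply/fps_lowMl/lowE | apply/fps_lowMr/lowS].
rewrite PE -sumrB; apply: fps_low_sum => N.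
rewrite -fps_of_z -[X in _ - X]mul1r -mulrBl.
(* The error [O(q^(n-N))] of the weight and the order [N] of the summand add up to [n], whatever [N]
   is. *)
rewrite -[n in fps_low n](subnK (ltnW (ltn_ord N))); apply: fps_lowM; first exact: fps_low_weight.
by move=> i iN; apply: hecke_poly_low.
Qed.

Let coefP k : fps_coef (E * S) k = \sum_(N < k.+1) (z N)`_k.
Proof.
have /eqP := @lowP k.+1 k (ltnSn k).
rewrite -rmorph_sum /= subr_eq0 => /eqP ->; by rewrite coef_sum.
Qed.

Let dissect_cvg r u : (r < 2)%N -> (forall n, u n = fps_of_poly (z (2 * n + r))) ->
  has_sum (@fps_cvg K) u (Fps (dissect 2 r (fps_coef (E * S)))).
Proof.
move=> r2 uE k; exists k.+1 => M kM.
under eq_bigr do rewrite uE.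
rewrite -rmorph_sum [LHS]/= coef_sum.
rewrite (@dissect_sum _ (fun N i => (z N)`_i)) //.
- by rewrite -[RHS]/(dissect 2 r (fps_coef (E * S)) k) /dissect coefP.
- exact: hecke_poly_low.
- exact: hecke_poly_parity.
Qed.

Lemma formal_identity : exists P : fps K,
  [/\ is_P (@fps_cvg K) a q P,
     has_sum (@fps_cvg K) (even_term a q) (Fps (dissect 2 0 (fps_coef P)))
   & has_sum (@fps_cvg K) (odd_term a q) (Fps (dissect 2 1 (fps_coef P)))].
Proof.
exists (E * S); split.
- by exists E, S; split=> //; apply: fps_low_cvg.
- by apply: dissect_cvg => // n; rewrite fps_of_z addn0 even_term_hecke.
- by apply: dissect_cvg => // n; rewrite fps_of_z addn1 odd_term_hecke.
Qed.
End FormalIdentity.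

(** * Complex sequences and series *)

Section CplxConvergence.
Local Open Scope classical_set_scope.
Variable R : realType.
Implicit Types (x y l : Cplx R) (u v : nat -> Cplx R) (b : nat -> R) (r c : R).

(** The modulus as a real number, open to real estimates; [|x|] itself lies in [Cplx R]. *)
Definition cnorm x : R := ComplexField.Normc.normc x.

Lemma normr_cnorm x : `|x| = ((cnorm x)%:C)%C. Proof. by []. Qed.
Lemma cnormM x y : cnorm (x * y) = cnorm x * cnorm y. Proof. exact: ComplexField.Normc.normcM. Qed.
Lemma cnormD x y : cnorm (x + y) <= cnorm x + cnorm y. Proof. exact: le_normcD. Qed.
Lemma cnormN x : cnorm (- x) = cnorm x. Proof. exact: normcN. Qed.
Lemma cnorm0 : cnorm 0 = 0. Proof. exact: ComplexField.Normc.normc0. Qed.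
Lemma cnorm1 : cnorm 1 = 1. Proof. exact: ComplexField.Normc.normc1. Qed.
Lemma cnorm_ge0 x : 0 <= cnorm x. Proof. by case: x => x y; rewrite /cnorm /= sqrtr_ge0. Qed.
Lemma cnormB x y : cnorm (x - y) <= cnorm x + cnorm y. Proof. by rewrite -(cnormN y) cnormD. Qed.
Lemma cnormX x n : cnorm (x ^+ n) = cnorm x ^+ n.
Proof. by elim: n => [|n IHn]; rewrite ?cnorm1 // !exprS cnormM IHn. Qed.
Lemma cnormX_le x r n : cnorm x <= r -> cnorm (x ^+ n) <= r ^+ n.
Proof.
by move=> xr; rewrite cnormX lerXn2r ?nnegrE ?cnorm_ge0 // (le_trans (cnorm_ge0 x)).
Qed.
Lemma cnormV x : cnorm x^-1 = (cnorm x)^-1. Proof. exact: ComplexField.Normc.normcV. Qed.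
Lemma cnorm_sum (I : finType) (F : I -> Cplx R) : cnorm (\sum_i F i) <= \sum_i cnorm (F i).
Proof.
elim/big_rec2: _ => [|i b x _ xb]; first by rewrite cnorm0.
by apply: le_trans (cnormD _ _) _; rewrite lerD2l.
Qed.
Lemma cnorm_Re x : `|complex.Re x| <= cnorm x.
Proof. by case: x => x y; rewrite /cnorm /= -sqrtr_sqr ler_wsqrtr // lerDl sqr_ge0. Qed.
Lemma cnorm_Im x : `|complex.Im x| <= cnorm x.
Proof. by case: x => x y; rewrite /cnorm /= -sqrtr_sqr ler_wsqrtr // lerDr sqr_ge0. Qed.
Lemma cnorm_le_ReIm x : cnorm x <= `|complex.Re x| + `|complex.Im x|.
Proof.
case: x => x y; rewrite /cnorm /=.
rewrite -[leRHS]ger0_norm ?addr_ge0 // -sqrtr_sqr ler_wsqrtr //.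
rewrite -(real_normK (num_real x)) -(real_normK (num_real y)).
have := normr_ge0 x; have := normr_ge0 y; nra.
Qed.

Lemma Cplx_cvgP u l : Cplx_cvg u l <-> (cnorm (u n - l) @[n --> \oo] --> (0 : R)).
Proof.
split.
  move=> /cvgrPdist_lt ul; apply/cvgrPdist_lt => e e0.
  have /ul : 0 < (e%:C)%C :> Cplx R by rewrite ltcR.
  apply: filterS => n; rewrite normr_cnorm ltcR sub0r normrN => ue.
  by rewrite ger0_norm ?cnorm_ge0 // -cnormN opprB.
move=> /cvgrPdist_lt ul; apply/cvgrPdist_lt => e.
(* A positive complex number has imaginary part zero. *)
case: e => e i; rewrite ltcE /= => /andP[/eqP -> e0].
have := ul e e0; apply: filterS => n; rewrite sub0r normrN ger0_norm ?cnorm_ge0 // => ue.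
by rewrite normr_cnorm -[(_ +i* 0)%C]/(e%:C)%C ltcR -cnormN opprB.
Qed.

Lemma Cplx_cvg_le u l b : (forall n, cnorm (u n - l) <= b n) -> b @ \oo --> (0 : R) -> Cplx_cvg u l.
Proof.
move=> ub b0; apply/Cplx_cvgP; apply: (squeeze_cvgr _ (cvg_cst _) b0).
by near=> n; rewrite cnorm_ge0 ub.
Unshelve. all: by end_near. Qed.

Lemma geometric_cvg0 c r : 0 <= r < 1 -> (c * r ^+ n @[n --> \oo] --> (0 : R)).
Proof. by case/andP=> r0 r1; apply: cvg_geometric; rewrite ger0_norm. Qed.

Lemma sum_geometric r n : 0 <= r < 1 -> \sum_(i < n) r ^+ i <= (1 - r)^-1.
Proof.
case/andP=> r0 r1; rewrite -[leRHS]mul1r ler_pdivlMr ?subr_gt0 // mulrC -opprB mulNr -subrX1.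
by rewrite opprB gerBl exprn_ge0.
Qed.

(** [v] is its initial value plus the series of its increments, which converges absolutely by
    comparison. *)
Let real_cvg (v : nat -> R) c r : 0 <= r < 1 ->
  (forall n, `|v n.+1 - v n| <= c * r ^+ n) -> exists t : R, v @ \oo --> t.
Proof.
move=> r01 dv; pose w n := v n.+1 - v n.
have sw : cvgn (series w).
  apply: normed_cvg; apply: (@series_le_cvg _ _ (geometric c r)) => [n|n|n|].
  - exact: normr_ge0.
  - exact: le_trans (dv n).
  - exact: dv.
  - by apply: is_cvg_geometric_series; case/andP: r01 => r0 r1; rewrite ger0_norm.
exists (limn (series w) + v 0%N).
have Ev : (fun n => series w n + v 0%N) = v.
  apply/funext => n; elim: n => [|n IHn]; first by rewrite /series /= big_geq // add0r.
  by rewrite /series /= big_nat_recr //= -/(series w n) addrAC IHn /w addrC subrK.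
by rewrite -{1}Ev; exact: (cvgD sw (cvg_cst _)).
Qed.

Lemma Cplx_complete u c r : 0 <= r < 1 ->
  (forall n, cnorm (u n.+1 - u n) <= c * r ^+ n) -> exists l, Cplx_cvg u l.
Proof.
move=> r01 du.
have [x ux] : exists x : R, complex.Re (u n) @[n --> \oo] --> x.
  apply: (@real_cvg _ c r) => // n; apply: le_trans (du n).
  by rewrite -raddfB cnorm_Re.
have [y uy] : exists y : R, complex.Im (u n) @[n --> \oo] --> y.
  apply: (@real_cvg _ c r) => // n; apply: le_trans (du n).
  by rewrite -raddfB cnorm_Im.
exists (x +i* y)%C; apply: (@Cplx_cvg_le _ _
  (fun n => `|complex.Re (u n) - x| + `|complex.Im (u n) - y|)).
  by move=> n; apply: le_trans (cnorm_le_ReIm _) _; case: (u n) => a b.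
rewrite -[X in _ --> X]addr0; apply: cvgD.
  rewrite -(@normr0 _ R); apply: cvg_norm; rewrite -(subrr x).
  by apply: cvgB; [exact: ux | exact: cvg_cst].
rewrite -(@normr0 _ R); apply: cvg_norm; rewrite -(subrr y).
by apply: cvgB; [exact: uy | exact: cvg_cst].
Qed.

Lemma Cplx_cvg_trans u v l c r : 0 <= r < 1 ->
  (forall n, cnorm (u n - v n) <= c * r ^+ n) -> Cplx_cvg v l -> Cplx_cvg u l.
Proof.
move=> r01 uv /Cplx_cvgP vl.
apply: (@Cplx_cvg_le _ _ (fun n => c * r ^+ n + cnorm (v n - l))).
  move=> n; have -> : u n - l = (u n - v n) + (v n - l) by rewrite addrA subrK.
  by apply: le_trans (cnormD _ _) _; rewrite lerD2r.
by rewrite -[X in _ --> X]addr0; apply: cvgD; [exact: geometric_cvg0 | exact: vl].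
Qed.

Lemma Cplx_cvgM u v l m : Cplx_cvg u l -> Cplx_cvg v m -> Cplx_cvg (fun n => u n * v n) (l * m).
Proof.
move=> /Cplx_cvgP ul /Cplx_cvgP vm.
apply: (@Cplx_cvg_le _ _ (fun n => cnorm (u n - l) * cnorm (v n - m) +
  (cnorm (u n - l) * cnorm m + cnorm l * cnorm (v n - m)))).
  move=> n; rewrite -!cnormM.
  have -> : u n * v n - l * m = (u n - l) * (v n - m) + ((u n - l) * m + l * (v n - m)) by ring.
  by apply: le_trans (cnormD _ _) _; rewrite lerD2l cnormD.
have -> : 0 = 0 * 0 + (0 * cnorm m + cnorm l * 0) :> R by ring.
apply: cvgD; first exact: (cvgM ul vm).
by apply: cvgD; [exact: (cvgM ul (cvg_cst _)) | exact: (cvgM (cvg_cst _) vm)].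
Qed.
End CplxConvergence.

(** * Uniform bounds for q-products *)

Section ProductBounds.
Variables (R : realType) (r : R).
Hypothesis r01 : 0 <= r < 1.
Implicit Types (x q : Cplx R) (b : R).

Let r0 : 0 <= r. Proof. by case/andP: r01. Qed.
Let r1 : 0 < 1 - r. Proof. by case/andP: r01; rewrite subr_gt0. Qed.

(** [1 + x <= exp x] for each factor, then the geometric series. *)
Lemma prod_geometric_le b n : 0 <= b -> \prod_(i < n) (1 + b * r ^+ i) <= expR (b / (1 - r)).
Proof.
move=> b0; apply: (@le_trans _ _ (expR (b * \sum_(i < n) r ^+ i))); last first.
  by rewrite ler_expR ler_wpM2l // sum_geometric.
elim: n => [|n IHn]; first by rewrite !big_ord0 mulr0 expR0.
rewrite !big_ord_recr /= [b * (_ + _)]mulrDr expRD; apply: ler_pM => //; last exact: expR_ge1Dx.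
  by apply: prodr_ge0 => i _; rewrite addr_ge0 ?mulr_ge0 ?exprn_ge0.
by rewrite addr_ge0 ?mulr_ge0 ?exprn_ge0.
Qed.

Lemma cnorm_prod_le n (F : nat -> Cplx R) (G : nat -> R) :
  (forall i, cnorm (F i) <= G i) -> cnorm (\prod_(i < n) F i) <= \prod_(i < n) G i.
Proof.
move=> FG; elim: n => [|n IHn]; first by rewrite !big_ord0 cnorm1.
by rewrite !big_ord_recr /= cnormM ler_pM ?cnorm_ge0.
Qed.

Lemma cnorm_qpoch_le b x q n : cnorm x <= b -> cnorm q <= r ->
  cnorm (qpoch x q n) <= expR (b / (1 - r)).
Proof.
move=> xb qr; have b0 : 0 <= b by exact: le_trans (cnorm_ge0 x) xb.
apply: le_trans (prod_geometric_le n b0).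
apply: (@cnorm_prod_le n (fun i => 1 - x * q ^+ i) (fun i => 1 + b * r ^+ i)) => i.
apply: le_trans (cnormB _ _) _; rewrite cnorm1 lerD2l cnormM ler_pM ?cnorm_ge0 //.
exact: cnormX_le.
Qed.

(** Adding up the increments of the product keeps a factor [cnorm x], which supplies the decay when
    [x] is a high power of [q]. *)
Lemma cnorm_qpoch_sub1_le b x q n : cnorm x <= b -> cnorm q <= r ->
  cnorm (qpoch x q n - 1) <= expR (b / (1 - r)) / (1 - r) * cnorm x.
Proof.
move=> xb qr; set c := expR _.
apply: (@le_trans _ _ (c * cnorm x * \sum_(i < n) r ^+ i)); last first.
  by rewrite [leRHS]mulrAC ler_wpM2l ?sum_geometric ?mulr_ge0 ?cnorm_ge0 ?expR_ge0.
elim: n => [|n IHn]; first by rewrite /qpoch !big_ord0 subrr cnorm0 mulr0.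
rewrite qpochS mulrBr mulr1 addrAC big_ord_recr mulrDr.
apply: le_trans (cnormB _ _) _; apply: lerD => //; rewrite !cnormM mulrA.
apply: ler_pM; rewrite ?mulr_ge0 ?cnorm_ge0 //; last exact: cnormX_le.
by rewrite ler_wpM2r ?cnorm_ge0 // cnorm_qpoch_le.
Qed.

(** The bound has the shape [1 + b * r ^+ k] that [prod_geometric_le] takes. *)
Lemma cnorm_1D_inv_le q k : cnorm q <= r ->
  1 + q ^+ k.+1 != 0 /\ cnorm (1 + q ^+ k.+1)^-1 <= 1 + (1 - r)^-1 * r ^+ k.
Proof.
move=> qr; set t := r ^+ k.
have t0 : 0 <= t by rewrite exprn_ge0.
have t1 : t <= 1 by apply: exprn_ile1 => //; case/andP: r01 => _ /ltW.
have qt : cnorm (q ^+ k.+1) <= r * t.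
  by rewrite -exprS; exact: cnormX_le.
have le1 : 1 - r * t <= cnorm (1 + q ^+ k.+1).
  rewrite lerBlDr -cnorm1 -[X in cnorm X](addrK (q ^+ k.+1)).
  by apply: le_trans (cnormB _ _) _; rewrite lerD2l.
have rt : r * t <= r by rewrite ler_piMr.
have pos : 0 < 1 - r * t by rewrite subr_gt0 (le_lt_trans rt) // -subr_gt0.
split; first by apply: contraTneq le1 => ->; rewrite cnorm0 -ltNge.
rewrite cnormV; apply: (@le_trans _ _ (1 - r * t)^-1).
  by rewrite lef_pV2 ?posrE // (lt_le_trans pos).
rewrite -[leLHS]mul1r ler_pdivrMr //.
have iv : (1 - r)^-1 * (1 - r) = 1 by rewrite mulVf // gt_eqF.
have ge1 : 0 <= (1 - r)^-1 by rewrite invr_ge0 ltW.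
move: (1 - r)^-1 iv ge1 => v iv ge1; clearbody t; clear le1 qt qr q.
(* Once [v * (1 - r) = 1], every summand in the bracket is nonnegative. *)
have -> : (1 + v * t) * (1 - r * t) = 1 + t * ((v * (1 - r) - 1) + (1 - r) + v * r * (1 - t)) by ring.
rewrite iv subrr add0r lerDl mulr_ge0 // addr_ge0 ?(ltW r1) // ?mulr_ge0 // ?subr_ge0 //.
Qed.

Lemma cnorm_qpochN_inv_le q n : cnorm q <= r ->
  cnorm (qpoch (- q) q n)^-1 <= expR ((1 - r)^-1 / (1 - r)).
Proof.
move=> qr; apply: le_trans (prod_geometric_le n _); last by rewrite invr_ge0 ltW.
rewrite -prodfV; apply: (@cnorm_prod_le n (fun i => (1 - - q * q ^+ i)^-1)
  (fun i => 1 + (1 - r)^-1 * r ^+ i)) => i.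
by rewrite mulNr opprK -exprS; case: (cnorm_1D_inv_le i qr).
Qed.
End ProductBounds.

Lemma cnorm_horner_le (R : realType) (rho : R) (p : {poly Cplx R}) (x : Cplx R) : cnorm x <= rho ->
  cnorm p.[x] <= \sum_(i < size p) cnorm p`_i * rho ^+ i.
Proof.
move=> xrho; rewrite horner_coef; apply: le_trans (cnorm_sum _) _; apply: ler_sum => i _.
by rewrite cnormM ler_wpM2l ?cnorm_ge0 ?cnormX_le.
Qed.

(** * Rearranging a series of polynomials into a power series *)

Section DoubleSeries.
Variables (R : realType) (rho c : R) (F : nat -> {poly Cplx R}).
Hypothesis rho01 : 0 <= rho < 1.
Hypothesis F_low : forall N i, (i < N)%N -> (F N)`_i = 0.
Hypothesis F_bound : forall N m, \sum_(i < m) cnorm (F N)`_i * rho ^+ i <= c * rho ^+ N.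
Variable x : Cplx R.
Hypothesis x_rho : cnorm x <= rho ^+ 2.

Let rho0 : 0 <= rho. Proof. by case/andP: rho01. Qed.
Let rho1 : rho <= 1. Proof. by case/andP: rho01 => _ /ltW. Qed.
Let c0 : 0 <= c.
Proof. by have := F_bound 0 0; rewrite big_ord0 expr0 mulr1. Qed.

Let xX i : cnorm (x ^+ i) <= rho ^+ i * rho ^+ i.
Proof.
by rewrite -exprD addnn -mul2n exprM; exact: cnormX_le.
Qed.

(** This is where [rho ^+ 2] enters: of the two factors [rho ^+ i] bounding [x ^+ i], one yields
    [rho ^+ M] for [i >= M], and [F_bound] absorbs the other. *)
Let tail_bound N M : cnorm ((F N).[x] - \sum_(i < M) (F N)`_i * x ^+ i) <= rho ^+ M * (c * rho ^+ N).
Proof.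
rewrite (@horner_coef_wide _ (M + size (F N))) ?leq_addl // big_split_ord /= addrAC subrr add0r.
apply: le_trans (cnorm_sum _) _.
apply: le_trans _ (ler_wpM2l (exprn_ge0 M rho0) (F_bound N (M + size (F N)))).
rewrite mulr_sumr big_split_ord /= -[leLHS]add0r; apply: lerD.
  by apply: sumr_ge0 => i _; rewrite !mulr_ge0 ?cnorm_ge0 ?exprn_ge0.
apply: ler_sum => i _; rewrite cnormM mulrCA ler_wpM2l ?cnorm_ge0 //.
apply: le_trans (xX _) _; rewrite ler_wpM2r ?exprn_ge0 //.
by apply: ler_wiXn2l; rewrite ?leq_addr.
Qed.

(** By [F_low] the first [M] coefficients involve only [N < M], so the difference is a sum of [M]
    tails. *)
Lemma double_series_partial M :
  cnorm (\sum_(i < M) (\sum_(N < i.+1) (F N)`_i) * x ^+ i - \sum_(N < M) (F N).[x])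
    <= c / (1 - rho) * rho ^+ M.
Proof.
have -> : \sum_(i < M) (\sum_(N < i.+1) (F N)`_i) * x ^+ i =
    \sum_(N < M) \sum_(i < M) (F N)`_i * x ^+ i.
  rewrite exchange_big /=; apply: eq_bigr => i _; rewrite -mulr_suml; congr (_ * _).
  case: i => k kM /=; rewrite -(subnKC kM) big_split_ord /= [X in _ = _ + X]big1 ?addr0 // => j _.
  by rewrite F_low //=; lia.
rewrite -cnormN opprB -sumrB; apply: le_trans (cnorm_sum _) _.
apply: (@le_trans _ _ (\sum_(N < M) rho ^+ M * (c * rho ^+ N))).
  by apply: ler_sum => N _; exact: tail_bound.
rewrite -mulr_sumr -mulr_sumr mulrC; apply: ler_wpM2r; first exact: exprn_ge0.
by apply: ler_wpM2l => //; exact: sum_geometric.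
Qed.

Lemma double_series_cvg : exists2 L : Cplx R,
  has_sum (@Cplx_cvg R) (fun N => (F N).[x]) L
  & has_sum (@Cplx_cvg R) (fun i => (\sum_(N < i.+1) (F N)`_i) * x ^+ i) L.
Proof.
have [L hL] : exists L, has_sum (@Cplx_cvg R) (fun N => (F N).[x]) L.
  apply: (@Cplx_complete _ _ c rho) => // n.
  rewrite big_ord_recr /= addrAC subrr add0r; apply: le_trans (F_bound n (size (F n))).
  by apply: cnorm_horner_le; apply: le_trans x_rho _; rewrite expr2 ler_piMr.
by exists L => //; apply: Cplx_cvg_trans rho01 double_series_partial hL.
Qed.
End DoubleSeries.

(** * Growth of the coefficients of [hecke_poly] *)

Section HeckeBound.
Variables (R : realType) (a : Cplx R) (rho : R).
Hypothesis rho01 : 0 <= rho < 1.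

Let rho0 : 0 <= rho. Proof. by case/andP: rho01. Qed.
Let b := 1 + cnorm a + cnorm a^-1.
Let b1 : 1 <= b. Proof. by rewrite /b -addrA lerDl addr_ge0 ?cnorm_ge0. Qed.
Let bX_ge0 n : 0 <= b ^+ n. Proof. by rewrite exprn_ge0 // (le_trans ler01). Qed.

Let cnorm_jcoef j : cnorm (jcoef a a^-1 j) <= 2 * b ^+ j.
Proof.
have b_ge x j' : cnorm x <= b -> cnorm x ^+ j' <= b ^+ j'.
  by move=> xb; rewrite lerXn2r ?nnegrE ?cnorm_ge0 // (le_trans ler01).
case: j => [|j]; first by rewrite cnorm1 expr0 mulr1 ler1n.
rewrite /jcoef cnormM cnormX cnormN cnorm1 expr1n mul1r mulr_natl mulr2n.
apply: le_trans (cnormD _ _) _; rewrite !cnormX; apply: lerD; apply: b_ge.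
  by rewrite /b addrAC lerDr addr_ge0 ?cnorm_ge0.
by rewrite /b lerDr addr_ge0 ?cnorm_ge0.
Qed.

Let cnorm_hecke N i : cnorm (hecke a%:P a^-1%:P 'X N)`_i <= 2 * N.+1%:R * b ^+ N.
Proof.
elim/ltn_ind: N i => -[|[|N]] IHN i.
- by rewrite coef1 mulr1 mulr1; case: (i == 0%N); rewrite ?cnorm1 ?cnorm0 ?ler1n ?ler0n.
- rewrite hecke1 -rmorph_jcoef coefCM coefXn.
  apply: (@le_trans _ _ (2 * b ^+ 1)); last by rewrite -mulrA ler_wpM2l ?ler_peMl ?ler1n.
  case: (i == 3%N); first by rewrite mulr1; exact: cnorm_jcoef.
  by rewrite mulr0 cnorm0 mulr_ge0.
rewrite heckeSS -rmorph_jcoef coefB coefCM coefXn coefXnM.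
apply: le_trans (cnormB _ _) _.
apply: (@le_trans _ _ (2 * b ^+ N.+2 + 2 * N.+1%:R * b ^+ N.+2)); last first.
  by rewrite -mulrDl ler_wpM2r // -[X in X + _ <= _]mulr1 -mulrDr ler_wpM2l // -natr1 -natr1; lra.
apply: lerD.
  case: (_ == _); first by rewrite mulr1; exact: cnorm_jcoef.
  by rewrite mulr0 cnorm0 mulr_ge0.
apply: (@le_trans _ _ (2 * N.+1%:R * b ^+ N)); last first.
  by rewrite ler_wpM2l ?mulr_ge0 // ler_weXn2l //; lia.
by case: ifP => _; [rewrite cnorm0 !mulr_ge0 | exact: IHN].
Qed.

Let cnorm_hecke_poly N i : cnorm (hecke_poly a N)`_i <= 4 * (2 * b) ^+ N.
Proof.
have hle k : cnorm (hecke a%:P a^-1%:P 'X N)`_k <= 2 * (2 * b) ^+ N.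
  apply: le_trans (cnorm_hecke N k) _; rewrite exprMn mulrA ler_wpM2r // ler_wpM2l //.
  by rewrite -natrX ler_nat ltn_expl.
have -> : 4 * (2 * b) ^+ N = 2 * (2 * b) ^+ N + 2 * (2 * b) ^+ N by rewrite -mulrDl -natrD.
rewrite /hecke_poly mulrDl mul1r coefD -exprM coefXnM.
apply: le_trans (cnormD _ _) _; apply: lerD => //.
by case: ifP => _ //; rewrite cnorm0 !mulr_ge0 ?exprn_ge0 ?mulr_ge0 // (le_trans ler01).
Qed.

(** The product is the [N]-th power of [2 * b * rho ^+ N], which drops below 1 from some [n0] on; up
    to [n0] it is at most [(2 * b) ^+ n0]. *)
Let growth_bound : exists K, forall N, (2 * b) ^+ N * rho ^+ (N * N) <= K.
Proof.
have b2 : 1 <= 2 * b by have := b1; lra.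
have b20 : 0 <= 2 * b := le_trans ler01 b2.
have /cvgrPdist_lt/(_ 1 ltr01)[n0 _ n0P] := geometric_cvg0 (2 * b) rho01.
exists ((2 * b) ^+ n0) => N; rewrite exprM -exprMn.
have [Nn0|n0N] := leqP N n0.
  apply: (@le_trans _ _ ((2 * b) ^+ N)); last by rewrite ler_weXn2l.
  rewrite lerXn2r ?nnegrE ?(mulr_ge0 b20) ?exprn_ge0 //.
  by rewrite ler_piMr // exprn_ile1 //; case/andP: rho01 => _ /ltW.
apply: (@le_trans _ _ 1); last by rewrite exprn_ege1.
apply: exprn_ile1; first by rewrite (mulr_ge0 b20) ?exprn_ge0.
have := n0P N (ltnW n0N); rewrite /= sub0r normrN ger0_norm; first by move/ltW.
by rewrite (mulr_ge0 b20) ?exprn_ge0.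
Qed.

(** All exponents are at least [N * N + 2 * N]: the square absorbs the growth of the coefficients,
    and [2 * N] is left. Half of that later pays for the loss [rho^(-N)] in the weights. *)
Lemma hecke_poly_bound : exists c, forall N m,
  \sum_(i < m) cnorm (hecke_poly a N)`_i * rho ^+ i <= c * rho ^+ (2 * N).
Proof.
have [K KP] := growth_bound; exists (4 * K / (1 - rho)) => N m.
set k := (N * (N + 2))%N.
apply: (@le_trans _ _ (\sum_(i < k + m) cnorm (hecke_poly a N)`_i * rho ^+ i)).
  rewrite addnC big_split_ord /= lerDl; apply: sumr_ge0 => i _.
  by rewrite mulr_ge0 ?cnorm_ge0 ?exprn_ge0.
rewrite big_split_ord /= big1 ?add0r => [|i _]; last first.
  suff -> : (hecke_poly a N)`_i = 0 by rewrite cnorm0 mul0r.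
  apply/eqP; apply: contraTT (ltn_ord i) => /hecke_poly_support[]; rewrite -/k.
  by rewrite leqNgt.
apply: (@le_trans _ _ (4 * (2 * b) ^+ N * rho ^+ k * \sum_(i < m) rho ^+ i)).
  rewrite mulr_sumr; apply: ler_sum => i _; rewrite exprD mulrA ler_wpM2r ?exprn_ge0 //.
  by rewrite ler_wpM2r ?exprn_ge0.
have b20 : 0 <= 2 * b by rewrite mulr_ge0 // (le_trans ler01).
apply: (@le_trans _ _ (4 * (2 * b) ^+ N * rho ^+ k * (1 - rho)^-1)).
  by rewrite ler_wpM2l ?sum_geometric // !mulr_ge0 ?exprn_ge0.
rewrite [leRHS]mulrAC; apply: ler_wpM2r.
  by rewrite invr_ge0 subr_ge0; case/andP: rho01 => _ /ltW.
have -> : rho ^+ k = rho ^+ (N * N) * rho ^+ (2 * N) by rewrite -exprD; congr (_ ^+ _); rewrite /k; lia.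
by rewrite -[leLHS]mulrA -[leRHS]mulrA ler_wpM2l // mulrA ler_wpM2r ?exprn_ge0.
Qed.
End HeckeBound.

(** * The identity for complex [a] and [q] *)

Section AnalyticIdentity.
Variables (R : realType) (a : Cplx R).
Hypothesis a0 : a != 0.
Let z := hecke_poly a.
(** The power series coefficients of [P_a]; they depend on [a] alone, so one sequence serves every
    [q]. *)
Let coefA i := \sum_(N < i.+1) (z N)`_i.

Let aU : a \is a GRing.unit. Proof. by rewrite unitfE. Qed.

Let z_horner q N : (z N).[q] = (1 + (q ^+ 2) ^+ N.+1) * hecke a a^-1 q N.
Proof.
rewrite /z /hecke_poly hornerM hornerD -exprM hornerXn hornerC -exprM.
by rewrite -/(horner_eval q _) rmorph_hecke /= /horner_eval !hornerC hornerX.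
Qed.

Let dissect_even i : dissect 2 0 coefA i = \sum_(n < i.+1) (z (2 * n))`_i.
Proof.
rewrite -(@dissect_sum _ (fun N i => (z N)`_i) 0 i.+1 i) //.
- by apply: eq_bigr => n _; rewrite addn0.
- exact: hecke_poly_low.
- exact: hecke_poly_parity.
Qed.

Let dissect_odd i : dissect 2 1 coefA i = \sum_(n < i.+1) (z (2 * n).+1)`_i.
Proof.
rewrite -(@dissect_sum _ (fun N i => (z N)`_i) 1 i.+1 i) //.
- by apply: eq_bigr => n _; rewrite addn1.
- exact: hecke_poly_low.
- exact: hecke_poly_parity.
Qed.

Section FixedNome.
Variable q : Cplx R.
Hypothesis q1 : cnorm q < 1.

(* The arithmetic mean of [|q|] and [1], so that [|q| <= rho ^ 2]. *)
Let rho : R := (1 + cnorm q) / 2.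
Let rho01 : 0 <= rho < 1.
Proof. by rewrite /rho; have := cnorm_ge0 q; move: q1; move: (cnorm q) => t; lra. Qed.
Let rho0 : 0 <= rho. Proof. by case/andP: rho01. Qed.
Let rho1 : rho <= 1. Proof. by case/andP: rho01 => _ /ltW. Qed.
Let q_rho2 : cnorm q <= rho ^+ 2.
Proof. by rewrite /rho; move: (cnorm q) => t; have := sqr_ge0 (1 - t); nra. Qed.
Let qX_rho n : (0 < n)%N -> cnorm (q ^+ n) <= rho.
Proof.
move=> n0; apply: le_trans (cnormX_le n q_rho2) _; rewrite -exprM.
by apply: (@le_trans _ _ (rho ^+ 1)) => //; apply: ler_wiXn2l => //; lia.
Qed.

Let subseries_cvg (f : nat -> nat) : (forall n, n <= f n)%N -> exists2 L : Cplx R,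
  has_sum (@Cplx_cvg R) (fun n => (z (f n)).[q]) L
  & has_sum (@Cplx_cvg R) (fun i => (\sum_(n < i.+1) (z (f n))`_i) * q ^+ i) L.
Proof.
move=> fn; have [c cP] := hecke_poly_bound a rho01.
have c0 : 0 <= c by have := cP 0 0; rewrite big_ord0 expr0 mulr1.
apply: (@double_series_cvg _ rho c (fun n => z (f n)) rho01) => // [n i i_n|n m].
  by apply: hecke_poly_low; apply: leq_trans i_n (fn n).
apply: le_trans (cP _ _) _; rewrite ler_wpM2l // ler_wiXn2l //.
by have := fn n; lia.
Qed.

Let E_cvg : exists E, Cplx_cvg (qpoch (q ^+ 4) (q ^+ 4)) E.
Proof.
apply: (@Cplx_complete _ _ (expR (rho / (1 - rho))) rho) => // n.
rewrite qpochS mulrBr mulr1 addrAC subrr add0r cnormN cnormM.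
apply: ler_pM; rewrite ?cnorm_ge0 //; first by apply: cnorm_qpoch_le; rewrite ?qX_rho.
by rewrite -exprS; apply: le_trans (cnormX_le _ (qX_rho _)) _ => //; rewrite ler_wiXn2l.
Qed.

Let unitQ k : 1 + (q ^+ 2) ^+ k.+1 \is a GRing.unit.
Proof. by rewrite unitfE; have [] := cnorm_1D_inv_le rho01 k (qX_rho (ltn0Sn 1)). Qed.

Let S_cvg : exists S, has_sum (@Cplx_cvg R) (S_term a q) S.
Proof.
have q2 := qX_rho (ltn0Sn 1).
pose c := expR (cnorm (a * q) / (1 - rho)) * expR (cnorm (q / a) / (1 - rho))
  * expR ((1 - rho)^-1 / (1 - rho)).
apply: (@Cplx_complete _ _ c rho) => // n.
rewrite big_ord_recr /= addrAC subrr add0r /S_term !cnormM /c.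
rewrite mulrAC; apply: ler_pM; rewrite ?mulr_ge0 ?cnorm_ge0 //.
  apply: ler_pM; rewrite ?mulr_ge0 ?cnorm_ge0 //; last exact: cnorm_qpochN_inv_le.
  by apply: ler_pM; rewrite ?cnorm_ge0 //; exact: cnorm_qpoch_le.
by rewrite exprM; apply: cnormX_le.
Qed.

(** One constant serves all [M] and [N], since both Pochhammer arguments in [weightE] have modulus
    at most [rho ^+ (M - N)]. *)
Let weight_bound : exists2 c, 0 <= c & forall M N, (N < M)%N ->
  cnorm (weight (q ^+ 2) M N - 1) <= c * rho ^+ (M - N).
Proof.
have q2 := qX_rho (ltn0Sn 1).
pose k := expR (1 / (1 - rho)) / (1 - rho).
have k0 : 0 <= k.
  by rewrite divr_ge0 ?expR_ge0 // subr_ge0.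
exists (k * expR (1 / (1 - rho)) + k); first by rewrite addr_ge0 // mulr_ge0 // expR_ge0.
move=> M N NM; rewrite weightE //.
have small n : cnorm ((q ^+ 2) ^+ n) <= 1.
  by apply: le_trans (cnormX_le n q2) _; rewrite exprn_ile1.
set x := qpoch _ _ _; set y := qpoch _ _ _.
have -> : x * y - 1 = (x - 1) * y + (y - 1) by ring.
apply: le_trans (cnormD _ _) _; rewrite [leRHS]mulrDl; apply: lerD.
  rewrite cnormM mulrAC; apply: ler_pM; rewrite ?cnorm_ge0 //; last exact: cnorm_qpoch_le.
  apply: le_trans (cnorm_qpoch_sub1_le rho01 _ (small _) q2) _; rewrite ler_wpM2l //.
  by apply: le_trans (cnormX_le _ q2) _; rewrite ler_wiXn2l //; lia.
apply: le_trans (cnorm_qpoch_sub1_le rho01 _ (small _) q2) _; rewrite ler_wpM2l //.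
exact: cnormX_le.
Qed.

Lemma P_power_series : exists2 P : Cplx R, is_P (@Cplx_cvg R) a q P
  & has_sum (@Cplx_cvg R) (fun n => coefA n * q ^+ n) P.
Proof.
have [E hE] := E_cvg; have [S hS] := S_cvg.
exists (E * S); first by exists E, S; split; [exact: hE | exact: hS | reflexivity].
have [c cP] := hecke_poly_bound a rho01.
have c0 : 0 <= c by have := cP 0 0; rewrite big_ord0 expr0 mulr1.
have cP' N m : \sum_(i < m) cnorm (z N)`_i * rho ^+ i <= c * rho ^+ N.
  by apply: le_trans (cP _ _) _; rewrite ler_wpM2l // ler_wiXn2l //; lia.
have [k k0 kP] := weight_bound.
(* The sums of [(z N).[q]] stand in the middle: geometrically close to the power series on one side
   and to the product of partial sums on the other. *)
apply: (Cplx_cvg_trans rho01 (v := fun M => \sum_(N < M) (z N).[q])).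
  by move=> M; apply: double_series_partial cP' _ q_rho2 M => // N i; exact: hecke_poly_low.
apply: (Cplx_cvg_trans rho01 (c := k * c / (1 - rho))) (Cplx_cvgM hE hS) => M.
rewrite (P_sum (mulrV aU) unitQ) -sumrB.
apply: le_trans (cnorm_sum _) _.
apply: (@le_trans _ _ (\sum_(N < M) k * c * rho ^+ M * rho ^+ N)).
  apply: ler_sum => N _; rewrite -z_horner -[X in X - _]mul1r -mulrBl cnormM -cnormN opprB.
  (* The weight error and the summand together give exponent [M + N]: summable over [N], with
     [rho ^+ M] to spare. *)
  have -> : k * c * rho ^+ M * rho ^+ N = (k * rho ^+ (M - N)) * (c * rho ^+ (2 * N)).
    rewrite mulrACA -!mulrA -!exprD; congr (_ * (_ * _ ^+ _)).
    by have := ltn_ord N; lia.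
  apply: ler_pM; rewrite ?cnorm_ge0 ?kP //.
  by apply: le_trans (cP N (size (z N))); apply: cnorm_horner_le; rewrite -[q]expr1 qX_rho.
rewrite -mulr_sumr [leRHS]mulrAC ler_wpM2l ?sum_geometric //.
by rewrite !mulr_ge0 ?exprn_ge0.
Qed.

Lemma even_part : exists2 L : Cplx R,
  has_sum (@Cplx_cvg R) (fun n => dissect 2 0 coefA n * q ^+ n) L
  & has_sum (@Cplx_cvg R) (even_term a q) L.
Proof.
have [|L hz hA] := @subseries_cvg (fun n => 2 * n)%N; first by move=> n; lia.
exists L.
  by rewrite (_ : (fun n => _) = (fun i => (\sum_(n < i.+1) (z (2 * n))`_i) * q ^+ i)) //;
    apply/funext => i; rewrite dissect_even.
rewrite (_ : even_term a q = (fun n => (z (2 * n)).[q])) //.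
by apply/funext => n; rewrite z_horner even_term_hecke.
Qed.

Lemma odd_part : exists2 L : Cplx R,
  has_sum (@Cplx_cvg R) (fun n => dissect 2 1 coefA n * q ^+ n) L
  & has_sum (@Cplx_cvg R) (odd_term a q) L.
Proof.
have [|L hz hA] := @subseries_cvg (fun n => (2 * n).+1)%N; first by move=> n; lia.
exists L.
  by rewrite (_ : (fun n => _) = (fun i => (\sum_(n < i.+1) (z (2 * n).+1)`_i) * q ^+ i)) //;
    apply/funext => i; rewrite dissect_odd.
rewrite (_ : odd_term a q = (fun n => (z (2 * n).+1).[q])) //.
by apply/funext => n; rewrite z_horner odd_term_hecke.
Qed.
End FixedNome.
End AnalyticIdentity.

Theorem theorem1 (R : realType) :
  (* a an indeterminate, q a formal variable *)
  (let a : fps (ratfun R) := fps_const (indet R) in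
   let q : fps (ratfun R) := fps_X (ratfun R) in
   exists P : fps (ratfun R),
     [/\ is_P (@fps_cvg (ratfun R)) a q P,
         has_sum (@fps_cvg (ratfun R)) (even_term a q)
           (Fps (dissect 2 0 (fps_coef P)))
       & has_sum (@fps_cvg (ratfun R)) (odd_term a q)
           (Fps (dissect 2 1 (fps_coef P)))])
  /\
  (* a a nonzero complex number, |q| < 1 *)
  (forall a : Cplx R, a != 0 ->
   exists A : nat -> Cplx R,
     (forall q : Cplx R, `|q| < 1 ->
        exists2 P : Cplx R, is_P (@Cplx_cvg R) a q P
          & has_sum (@Cplx_cvg R) (fun n => A n * q ^+ n) P) /\
     (forall q : Cplx R, `|q| < 1 ->
        exists2 L : Cplx R,
          has_sum (@Cplx_cvg R) (fun n => dissect 2 0 A n * q ^+ n) L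
          & has_sum (@Cplx_cvg R) (even_term a q) L) /\
     (forall q : Cplx R, `|q| < 1 ->
        exists2 L : Cplx R,
          has_sum (@Cplx_cvg R) (fun n => dissect 2 1 A n * q ^+ n) L
          & has_sum (@Cplx_cvg R) (odd_term a q) L)).
Proof.
split.
  by apply: formal_identity; rewrite tofrac_eq0 polyX_eq0.
move=> a a0; exists (fun i => \sum_(N < i.+1) (hecke_poly a N)`_i).
have cnorm_lt1 (q : Cplx R) : `|q| < 1 -> cnorm q < 1.
  by rewrite normr_cnorm -(rmorph1 (real_complex R)) ltcR.
split; first by move=> q /cnorm_lt1; exact: P_power_series.
by split=> q /cnorm_lt1; [exact: even_part | exact: odd_part].
Qed.
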